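(* Let $S$ be a special schema and $u\in\mathcal V$. (1) For every predicate symbol $p$ lying in $\mathrm{need}(u)$ there exists a $pu$-couple for $S$. (2) For every labelled function symbol $f^{(l)}\in\mathrm{need}(u)$, either there is a Herbrand interpretation $i$ such that $S$ terminates under $i$ and the term $M[S]^i_e(u)$ contains the symbol $f$, or there is a predicate symbol $p\in\mathrm{need}(u)$ and a vector term $\mathbf t$ containing $f$ such that there exists a $p(\mathbf t)u$-couple for $S$.
   Context: Fix infinite sets $\mathcal F$ (function symbols), $\mathcal P$ (predicate symbols), $\mathcal V$ (variables), $\mathcal L$ (labels), and an arity map. Terms: variables, and $f(t_1,\dots,t_n)$ for $f\in\mathcal F$ of arity $n$ and terms $t_i$. Schemas are defined recursively: $\mathtt{skip}$; an assignment $y:=f^{(l)}(\mathbf x);$ ($\mathbf x$ a vector of $\mathrm{arity}(f)$ variables); sequences $U_1\cdots U_r$; $\mathtt{if}\ p^{(l)}(\mathbf x)\ \mathtt{then}\ T_1\ \mathtt{else}\ T_2$ (true and false parts); $\mathtt{while}\ q^{(l)}(\mathbf y)\ \mathtt{do}\ T$ (body). Distinct occurrences of a symbol carry distinct labels. $\mathrm{assig}(f^{(l)})=y$, $\mathrm{ref}(f^{(l)})=\mathbf x$ for the assignment $y:=f^{(l)}(\mathbf x)$; $\mathrm{ref}(p^{(l)})$ is the argument vector of a predicate occurrence. $p^{(l)}\sqsupseteq x$ means $x$ lies (at any depth) in the body or in the true/false part of $p^{(l)}$. Paths: letters $\underline{y:=f^{(l)}(\mathbf x)}$ for assignments and $\underline{p^{(l)},Z}$,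 $Z\in\{\mathit{true},\mathit{false}\}$. $\Pi(\mathtt{skip})=\{\varepsilon\}$; $\Pi(\text{assignment})=\{\text{its letter}\}$; $\Pi(U_1\cdots U_r)=\Pi(U_1)\cdots\Pi(U_r)$; $\Pi(\mathtt{if})=\underline{p^{(l)},\mathit{true}}\,\Pi(T_1)\cup\underline{p^{(l)},\mathit{false}}\,\Pi(T_2)$; $\Pi(\mathtt{while})=(\underline{q^{(l)},\mathit{true}}\,\Pi(T))^*\underline{q^{(l)},\mathit{false}}$. $\mathrm{pre}(X)$: finite prefixes. $\mu$ is a path-segment of $S$ if $\mu'\mu\mu''\in\Pi(S)$; terminal if possible with $\mu''$ empty. Herbrand semantics: an interpretation $i$ gives maps $p^i$ from tuples of terms to $\{\mathit{true},\mathit{false}\}$; function symbols are term constructors. $e(v)=v$. For a word $\mu$, $M[\mu]_e$ is the state obtained from $e$ by executing the assignment letters of $\mu$ in order. $\Pi(S,i,e)$ is the unique finite or infinite word whose finite prefixes lie in $\mathrm{pre}(\Pi(S))$, which lies in $\Pi(S)$ if finite, and such that for every prefix $\sigma\,\underline{p^{(l)},X}$, $p^i(M[\sigma]_e(\mathrm{ref}(p^{(l)})))=X$. If finite, $S$ terminates under $i$ and $M[S]^i_e=M[\Pi(S,i,e)]_e$. $S$ is free if every element of $\mathrm{pre}(\Pi(S))$ is a prefix of some $\Pi(S,i,e)$. $S$ is liberal if for every $i$ and every prefix $\mu\,\underline{v:=f^{(l)}(\mathbf a)}\,\nu\,\underline{w:=g^{(m)}(\mathbf b)}$ of $\Pi(S,i,e)$,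 the value of $v$ after $\mu\,\underline{v:=f^{(l)}(\mathbf a)}$ differs from the value of $w$ after the whole prefix (states computed by $M[\cdot]_e$). $S$ is special if no predicate symbol occurs more than once in $S$ (predicate-linear), $S$ is free and liberal, and for every if-predicate $p$ and $f\in\mathcal F$, occurrences $f^{(l)}$ in the true part and $f^{(m)}$ in the false part satisfy $\mathrm{assig}(f^{(l)})\ne\mathrm{assig}(f^{(m)})$. (Predicate symbols in a special schema are therefore identified without labels.) Data dependence: $f^{(l)}\rhd x$ if $S$ has a path-segment starting with the letter of $f^{(l)}$, ending with a letter of $x$, with no intermediate assignment to $\mathrm{assig}(f^{(l)})$, and $x$ references $\mathrm{assig}(f^{(l)})$; $f^{(l)}\rhd_{\mathrm{final}}u$ if $S$ has a terminal path-segment starting with the letter of $f^{(l)}$, $\mathrm{assig}(f^{(l)})=u$, and no later assignment to $u$. $\mathrm{need}(u)$ is the least set of labelled symbols with: $f^{(l)}\rhd_{\mathrm{final}}u\Rightarrow f^{(l)}\in\mathrm{need}(u)$; $x\in\mathrm{need}(u)$, $f^{(l)}\rhd x\Rightarrow f^{(l)}\in\mathrm{need}(u)$; $x\in\mathrm{need}(u)$, $p^{(l)}\sqsupseteq x\Rightarrow p^{(l)}\in\mathrm{need}(u)$. Couples: Herbrand interpretations $i,j$ form a $p(\mathbf t)$-couple $\{i,j\}$ if they differ only at the single predicate term $p(\mathbf t)$; it is a $p(\mathbf t)u$-couple for $S$ if moreover $S$ terminates under both and $M[S]^i_e(u)\ne M[S]^j_e(u)$; a $pu$-couple for $S$ is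 a $p(\mathbf t)u$-couple for $S$ for some $\mathbf t$. *)

(* Defs.v *)
From mathcomp Require Import all_boot.

Set Implicit Arguments.
Unset Strict Implicit.
Unset Printing Implicit Defensive.

Definition infinite_type (T : eqType) : Prop :=
  ~ exists s : seq T, forall x, x \in s.

Section Schemas.

Variables (F P V L : eqType) (arF : F -> nat) (arP : P -> nat).

Inductive term : Type :=
| Var (v : V)
| App (f : F) (ts : {ffun 'I_(arF f) -> term}).

Fixpoint contains (f : F) (t : term) : Prop :=
  match t with
  | Var _ => False
  | App g ts => g = f \/ exists k, contains f (ts k)
  end.

Definition vcontains (n : nat) (f : F) (ts : {ffun 'I_n -> term}) : Prop :=
  exists k, contains f (ts k).

(* A sequence U_1 ... U_r is rendered by iterating the binary [Seq] (and by
   [Skip] for r = 0); all notions below are insensitive to the bracketing. *)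
Inductive schema : Type :=
| Skip
| Assign (y : V) (f : F) (l : L) (x : {ffun 'I_(arF f) -> V})
| Seq (S1 S2 : schema)
| If (p : P) (l : L) (x : {ffun 'I_(arP p) -> V}) (T1 T2 : schema)
| While (q : P) (l : L) (y : {ffun 'I_(arP q) -> V}) (T : schema).

(* Labelled symbols: [inl (f, l)] is f^(l) and [inr (p, l)] is p^(l). *)
Definition lsym : Type := (F * L + P * L)%type.

Fixpoint lsyms (S : schema) : seq (F * L + P * L)%type :=
  match S with
  | Skip => [::]
  | Assign _ f l _ => [:: inl (f, l)]
  | Seq S1 S2 => lsyms S1 ++ lsyms S2
  | If p l _ T1 T2 => inr (p, l) :: lsyms T1 ++ lsyms T2
  | While q l _ T => inr (q, l) :: lsyms T
  end.

(* Distinct occurrences of a symbol carry distinct labels. *)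
Definition well_labelled (S : schema) : Prop := uniq (lsyms S).

Fixpoint preds (S : schema) : seq P :=
  match S with
  | Skip | Assign _ _ _ _ => [::]
  | Seq S1 S2 => preds S1 ++ preds S2
  | If p _ _ T1 T2 => p :: preds T1 ++ preds T2
  | While q _ _ T => q :: preds T
  end.

Fixpoint subschema (U S : schema) : Prop :=
  U = S \/
  match S with
  | Skip | Assign _ _ _ _ => False
  | Seq S1 S2 => subschema U S1 \/ subschema U S2
  | If _ _ _ T1 T2 => subschema U T1 \/ subschema U T2
  | While _ _ _ T => subschema U T
  end.

(* p^(l) \sqsupseteq x in S. *)
Definition encloses (S : schema) (p : P) (l : L) (x : lsym) : Prop :=
  (exists v T1 T2, subschema (@If p l v T1 T2) S /\
     (x \in lsyms T1 \/ x \in lsyms T2)) \/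
  (exists v T, subschema (@While p l v T) S /\ x \in lsyms T).

(* The letter of a predicate occurrence also carries its argument vector
   ref(p^(l)), which in a well-labelled schema is determined by p and l. *)
Inductive letter : Type :=
| LAssign (y : V) (f : F) (l : L) (x : {ffun 'I_(arF f) -> V})
| LPred (p : P) (l : L) (x : {ffun 'I_(arP p) -> V}) (Z : bool).

Definition sym_of (a : letter) : lsym :=
  match a with
  | LAssign _ f l _ => inl (f, l)
  | LPred p l _ _ => inr (p, l)
  end.

Definition assigns (v : V) (a : letter) : bool :=
  match a with LAssign y _ _ _ => y == v | LPred _ _ _ _ => false end.

Definition references (v : V) (a : letter) : bool :=
  match a with
  | LAssign _ f _ x => v \in codom x
  | LPred p _ x _ => v \in codom x
  end.

(* [paths S mu] : mu \in Pi(S). *)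
Inductive paths : schema -> seq letter -> Prop :=
| paths_skip : paths Skip [::]
| paths_assign y f l x : paths (@Assign y f l x) [:: LAssign y l x]
| paths_seq S1 S2 mu nu :
    paths S1 mu -> paths S2 nu -> paths (Seq S1 S2) (mu ++ nu)
| paths_if_true p l x T1 T2 mu :
    paths T1 mu -> paths (@If p l x T1 T2) (LPred l x true :: mu)
| paths_if_false p l x T1 T2 mu :
    paths T2 mu -> paths (@If p l x T1 T2) (LPred l x false :: mu)
| paths_while_false q l y T :
    paths (@While q l y T) [:: LPred l y false]
| paths_while_true q l y T mu nu :
    paths T mu -> paths (@While q l y T) nu ->
    paths (@While q l y T) (LPred l y true :: mu ++ nu).

Definition pre (X : seq letter -> Prop) (mu : seq letter) : Prop :=
  exists nu, X (mu ++ nu).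

Definition interp : Type := forall p : P, {ffun 'I_(arP p) -> term} -> bool.

Definition state : Type := V -> term.

(* The state e; as every state of interest is computed from it, it is built
   into [run], so that [run mu] is M[mu]_e. *)
Definition init : state := Var.

Definition veval (n : nat) (d : state) (x : {ffun 'I_n -> V}) :
  {ffun 'I_n -> term} := [ffun k => d (x k)].

Definition step (d : state) (a : letter) : state :=
  match a with
  | LAssign y f _ x => fun v => if v == y then App (veval d x) else d v
  | LPred _ _ _ _ => d
  end.

Definition run (mu : seq letter) : state := foldl step init mu.

Inductive word : Type :=
| Fin (s : seq letter)
| Inf (h : nat -> letter).

Definition prefix_of (mu : seq letter) (w : word) : Prop :=
  match w with
  | Fin s => exists nu, s = mu ++ nu
  | Inf h => mu = mkseq h (size mu)
  end.

(* [execution S i w] : w is the word Pi(S,i,e), given by its defining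
   property. *)
Definition execution (S : schema) (i : interp) (w : word) : Prop :=
  [/\ forall mu, prefix_of mu w -> pre (paths S) mu,
      forall s, w = Fin s -> paths S s
    & forall sigma p l x Z,
        prefix_of (rcons sigma (@LPred p l x Z)) w ->
        i p (veval (run sigma) x) = Z].

(* S terminates under i and M[S]^i_e = d. *)
Definition terminates_in (S : schema) (i : interp) (d : state) : Prop :=
  exists2 s, execution S i (Fin s) & d = run s.

Definition free (S : schema) : Prop :=
  forall mu, pre (paths S) mu ->
  exists i w, execution S i w /\ prefix_of mu w.

Definition liberal (S : schema) : Prop :=
  forall i w mu v f l a nu z g m b,
    let mu1 := rcons mu (@LAssign v f l a) in
    let mu2 := rcons (mu1 ++ nu) (@LAssign z g m b) in
    execution S i w -> prefix_of mu2 w -> run mu1 v <> run mu2 z.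

Definition predicate_linear (S : schema) : Prop := uniq (preds S).

Definition special (S : schema) : Prop :=
  [/\ predicate_linear S, free S, liberal S
    & forall p k c T1 T2, subschema (@If p k c T1 T2) S ->
      forall f y l a z m b,
        subschema (@Assign y f l a) T1 -> subschema (@Assign z f m b) T2 ->
        y <> z].

(* f^(l) \rhd x. *)
Definition data_dep (S : schema) (f : F) (l : L) (x : lsym) : Prop :=
  exists mu y a nu b mu',
    [/\ paths S (mu ++ @LAssign y f l a :: nu ++ b :: mu'),
        sym_of b = x, ~~ has (assigns y) nu & references y b].

(* f^(l) \rhd_final u. *)
Definition final_dep (S : schema) (f : F) (l : L) (u : V) : Prop :=
  exists mu a nu,
    paths S (mu ++ @LAssign u f l a :: nu) /\ ~~ has (assigns u) nu.

Inductive need (S : schema) (u : V) : lsym -> Prop :=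
| need_final f l : final_dep S f l u -> need S u (inl (f, l))
| need_data f l x :
    need S u x -> data_dep S f l x -> need S u (inl (f, l))
| need_control p l x :
    need S u x -> encloses S p l x -> need S u (inr (p, l)).

(* {i, j} is a p(t)-couple. *)
Definition couple (p : P) (t : {ffun 'I_(arP p) -> term}) (i j : interp) :
  Prop :=
  i p t <> j p t /\
  forall q (s : {ffun 'I_(arP q) -> term}),
    i q s <> j q s ->
    existT (fun r => {ffun 'I_(arP r) -> term}) q s = existT _ p t.

(* {i, j} is a p(t)u-couple for S. *)
Definition couple_for (S : schema) (p : P) (t : {ffun 'I_(arP p) -> term})
    (u : V) (i j : interp) : Prop :=
  couple t i j /\
  exists di dj, [/\ terminates_in S i di, terminates_in S j dj & di u <> dj u].

End Schemas.

(* Main.v *)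
Require Import Defs.
From mathcomp Require Import all_boot boolp.
From Stdlib Require List.

(* Freeness means that no path tests the same predicate term twice, so that an
   interpretation can be changed at will at predicate terms not met so far, and
   an interpretation that is false at almost all predicate terms terminates.

   Rank the symbols of need(u) by the length of their derivation, and let p be
   needed. For any path reaching p, with argument vector t, run S under two
   interpretations that differ exactly at p(t), one run passing through an
   assignment of least rank c + 1 controlled by p. When both runs have left p,
   the assigned variable w has different values in them: by liberality if the
   other run did not assign w, by the condition on true and false parts if it
   did. Such a difference is then carried to the end of both runs, by induction
   on the rank of the next use of w. If that use is an assignment, it passes to
   the assigned variable. If a test q enclosing symbols of rank at most that of
   the use is met with different arguments, the two runs are sent into different
   branches of q, which creates a difference with a use of smaller rank, unless
   that difference was already there before q. Tests of other predicates either
   cannot disturb w or are answered alike in both runs; a shortest way to the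
   use never meets one of the latter twice, which keeps the two runs
   compatible. So every path to p yields a p(t)u-couple.

   For a function symbol, follow a value containing it along data dependences
   to u or to a needed predicate, and use the couple found there. *)

Set Implicit Arguments.
Unset Strict Implicit.
Unset Printing Implicit Defensive.

Local Notation In := List.In.

(** * Membership and splitting for lists *)

Lemma In_cat (T : Type) (x : T) (s t : seq T) :
  In x (s ++ t) <-> In x s \/ In x t.
Proof.
elim: s => [|y s IHs] /=; first by split; [right | case].
by rewrite IHs or_assoc.
Qed.

Lemma In_map (T U : Type) (g : T -> U) (y : U) (s : seq T) :
  In y (map g s) <-> exists2 x, In x s & y = g x.
Proof.
elim: s => [|z s IHs] /=; first by split => // -[].
rewrite IHs; split=> [[<-|[x xs ->]]|[x [->|xs] ->]]; first by exists z; [left|].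
- by exists x; [right|].
- by left.
- by right; exists x.
Qed.

Lemma In_splitr (T : Type) (x : T) (s : seq T) :
  In x s -> exists s1 s2, s = s1 ++ x :: s2.
Proof.
elim: s => //= y s IHs [->|/IHs [s1 [s2 ->]]]; first by exists [::], s.
by exists (y :: s1), s2.
Qed.

Lemma has_last_split (T : Type) (a : pred T) (s : seq T) :
  has a s -> exists s1 x s2, [/\ s = s1 ++ x :: s2, a x & ~~ has a s2].
Proof.
elim: s => //= y s IHs; case: (boolP (has a s)) => [/IHs|nas].
  by case=> [s1 [x [s2 [-> ax nas]]]] _; exists (y :: s1), x, s2.
by rewrite orbF => ay; exists [::], y, s.
Qed.

Section Schemas.

Variables (F P V L : eqType) (arF : F -> nat) (arP : P -> nat).

Local Notation schema := (schema V L arF arP).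
Local Notation letter := (letter V L arF arP).
Local Notation state := (state V arF).
Local Notation term := (term V arF).
Local Notation interp := (interp V arF arP).
(* The stack of the schemas that remain to be executed. *)
Local Notation config := (seq schema).
Local Notation Skip := (Skip V L arF arP).
Local Notation Assign := (Assign arP).
Local Notation LAssign := (LAssign arP).
Local Notation LPred := (LPred arF).
Local Notation lsym := (lsym F P L).

Implicit Types (T C : schema) (K X : config) (mu nu pi tau : seq letter)
  (a : letter) (d : state) (i j : interp).

(** * Configurations *)

(** Packed as a dependent pair because the length of the argument vector depends on the
    predicate. *)
Definition header : Type := {p : P & (L * {ffun 'I_(arP p) -> V})%type}.

Definition hname (h : header) : P := projT1 h.
Definition hargs (h : header) : {ffun 'I_(arP (hname h)) -> V} := (projT2 h).2.
Definition hsym (h : header) : lsym := inr (hname h, (projT2 h).1).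
Definition hletter (h : header) (b : bool) : letter :=
  LPred (projT2 h).1 (hargs h) b.

Definition phead C : option header :=
  match C with
  | @If _ _ _ _ _ _ p l x _ _ | @While _ _ _ _ _ _ p l x _ =>
      Some (existT _ p (l, x))
  | _ => None
  end.

(* The schema executed after the test [C] has evaluated to [b]; an exited loop
   is treated as if it had the false part [Skip]. *)
Definition side C (b : bool) : schema :=
  match C with
  | @If _ _ _ _ _ _ _ _ _ T1 T2 => if b then T1 else T2
  | @While _ _ _ _ _ _ _ _ _ T => if b then T else Skip
  | _ => Skip
  end.

(** The stack waiting under the chosen branch: a loop whose body is entered is put back, to be
    tested again. *)
Definition ret C (b : bool) K : config :=
  match C with
  | @While _ _ _ _ _ _ _ _ _ _ => if b then C :: K else K
  | _ => K
  end.

Definition head_sym C : option lsym :=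
  match C with
  | @Defs.Assign _ _ _ _ _ _ _ f l _ => Some (inl (f, l))
  | _ => omap hsym (phead C)
  end.

Lemma head_sym_phead C h : phead C = Some h -> head_sym C = Some (hsym h).
Proof. by case: C => //= [p l x T1 T2|p l x T] [<-]. Qed.

Lemma lsyms_phead C h : phead C = Some h ->
  lsyms C = hsym h :: lsyms (side C true) ++ lsyms (side C false).
Proof. by case: C => //= [p l x T1 T2|p l x T] [<-] //=; rewrite cats0. Qed.

Lemma preds_phead C h : phead C = Some h ->
  preds C = hname h :: preds (side C true) ++ preds (side C false).
Proof. by case: C => //= [p l x T1 T2|p l x T] [<-] //=; rewrite cats0. Qed.

Lemma sub_lsyms_side C b h : phead C = Some h ->
  {subset lsyms (side C b) <= lsyms C}.
Proof.
by move=> /lsyms_phead -> x xC; rewrite inE mem_cat; case: b xC => ->; rewrite ?orbT.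
Qed.

Lemma sub_preds_side C b h : phead C = Some h ->
  {subset preds (side C b) <= preds C}.
Proof.
by move=> /preds_phead -> x xC; rewrite inE mem_cat; case: b xC => ->; rewrite ?orbT.
Qed.

Definition next C K a X : Prop :=
  match C with
  | @Defs.Assign _ _ _ _ _ _ y f l x => a = LAssign y l x /\ X = K
  | _ => exists h b, [/\ phead C = Some h, a = hletter h b
                       & X = side C b :: ret C b K]
  end.

(** Small-step counterpart of [paths] with the unfinished program made explicit, so that a run can
    be cut after any letter and resumed along another continuation. *)
Inductive crun : config -> seq letter -> config -> Prop :=
| crun_refl K : crun K [::] K
| crun_skip K mu X : crun K mu X -> crun (Skip :: K) mu X
| crun_seq T1 T2 K mu X :
    crun (T1 :: T2 :: K) mu X -> crun (Seq T1 T2 :: K) mu X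
| crun_next C K a K1 mu X :
    next C K a K1 -> crun K1 mu X -> crun (C :: K) (a :: mu) X.

Lemma crun_trans K mu X nu Y : crun K mu X -> crun X nu Y -> crun K (mu ++ nu) Y.
Proof.
move=> KX; elim: KX nu Y => //=.
- by move=> K0 mu0 X0 _ IH nu Y /IH; apply: crun_skip.
- by move=> T1 T2 K0 mu0 X0 _ IH nu Y /IH; apply: crun_seq.
- by move=> C K0 a K1 mu0 X0 st _ IH nu Y /IH; apply: crun_next.
Qed.

Lemma next_pred C K h b : phead C = Some h ->
  next C K (hletter h b) (side C b :: ret C b K).
Proof. by case: C => //= [p l x T1 T2|p l x T] hC; exists h, b. Qed.

Lemma crun_pred C K h b mu X : phead C = Some h ->
  crun (side C b :: ret C b K) mu X -> crun (C :: K) (hletter h b :: mu) X.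
Proof. by move=> hC; apply: crun_next; apply: next_pred. Qed.

Lemma crun_rcons_next K pi C X a Y :
  crun K pi (C :: X) -> next C X a Y -> crun K (rcons pi a) Y.
Proof.
move=> KC st; rewrite -cats1; apply: crun_trans KC _.
by apply: crun_next st _; apply: crun_refl.
Qed.

Lemma paths_crun T tau K : paths T tau -> crun (T :: K) tau K.
Proof.
move=> Tt; elim: Tt K => {T tau}.
- by move=> K; apply/crun_skip/crun_refl.
- by move=> y f l x K; apply: (@crun_next _ _ _ K) => //; apply: crun_refl.
- move=> S1 S2 mu nu _ IH1 _ IH2 K; apply: crun_seq.
  exact: crun_trans (IH1 _) (IH2 _).
- move=> p l x T1 T2 mu _ IH K.
  exact: (@crun_pred (If l x T1 T2) K (existT _ p (l, x)) true).
- move=> p l x T1 T2 mu _ IH K.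
  exact: (@crun_pred (If l x T1 T2) K (existT _ p (l, x)) false).
- move=> q l y T K.
  apply: (@crun_pred (While l y T) K (existT _ q (l, y)) false) => //=.
  exact/crun_skip/crun_refl.
- move=> q l y T mu nu _ IH1 _ IH2 K.
  apply: (@crun_pred (While l y T) K (existT _ q (l, y)) true) => //=.
  exact: crun_trans (IH1 _) (IH2 _).
Qed.

Fixpoint paths_config K mu : Prop :=
  if K is T :: K' then
    exists mu1 mu2, [/\ mu = mu1 ++ mu2, paths T mu1 & paths_config K' mu2]
  else mu = [::].

Lemma crun_paths_config K mu : crun K mu [::] -> paths_config K mu.
Proof.
move: {-2}[::] (erefl ([::] : config)) => X X0 KX; elim: KX X0 => {K mu X}.
- by move=> K ->.
- move=> K mu X _ IH /IH Kmu; exists [::], mu; split=> //; exact: paths_skip.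
- move=> T1 T2 K mu X _ IH /IH /= [mu1 [mu2 [-> p1 [mu3 [mu4 [-> p2 p3]]]]]].
  by exists (mu1 ++ mu3), mu4; rewrite catA; split=> //; apply: paths_seq.
- move=> C K a K1 mu X st _ IH /IH {IH}.
  case: C st => //=.
  + by move=> [? [? []]].
  + move=> y f l x [-> ->] Kmu; exists [:: LAssign y l x], mu; split=> //.
    exact: paths_assign.
  + by move=> ? ? [? [? []]].
  + move=> p l x T1 T2 [h [b [[<-] -> ->]]] [mu1 [mu2 [-> p1 p2]]].
    exists (LPred l x b :: mu1), mu2; split=> //.
    by case: b p1 {p2}; [apply: paths_if_true | apply: paths_if_false].
  + move=> q l y T [h [b [[<-] -> ->]]] [mu1 [mu2 [-> p1 p2]]].
    case: b p1 p2 => [p1 [mu3 [mu4 [-> p2 p3]]]|p1 p2].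
      exists (LPred l y true :: mu1 ++ mu3), mu4.
      by rewrite /= catA; split=> //; apply: paths_while_true.
    exists [:: LPred l y false], mu2; split=> //; last exact: paths_while_false.
    by inversion p1.
Qed.

Lemma paths_crunE T mu : paths T mu <-> crun [:: T] mu [::].
Proof.
split=> [/paths_crun//|/crun_paths_config [mu1 [mu2 [-> p1 /= ->]]]].
by rewrite cats0.
Qed.

Lemma paths_exists T : exists tau, paths T tau.
Proof.
elim: T => [|y f l x|T1 [t1 p1] T2 [t2 p2]|p l x T1 [t1 p1] T2 _|q l y T _].
- by exists [::]; apply: paths_skip.
- by exists [:: LAssign y l x]; apply: paths_assign.
- by exists (t1 ++ t2); apply: paths_seq.
- by exists (LPred l x true :: t1); apply: paths_if_true.
- by exists [:: LPred l y false]; apply: paths_while_false.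
Qed.

Lemma crun_complete K : exists mu, crun K mu [::].
Proof.
elim: K => [|T K [mu Kmu]]; first by exists [::]; apply: crun_refl.
by have [tau /(paths_crun K) Tt] := paths_exists T; exists (tau ++ mu); apply: crun_trans Kmu.
Qed.

Lemma crun_pre T mu K : crun [:: T] mu K -> pre (paths T) mu.
Proof.
move=> TK; have [nu Knu] := crun_complete K.
by exists nu; apply/paths_crunE; apply: crun_trans Knu.
Qed.

Lemma crun_split K mu nu X : crun K (mu ++ nu) X ->
  exists2 Y, crun K mu Y & crun Y nu X.
Proof.
move E: (mu ++ nu) => rho Krho; elim: Krho mu nu E => {K rho X}.
- by move=> K [|//] [|//] _; exists K; apply: crun_refl.
- by move=> K rho X _ IH mu nu /IH [Y] KY YX; exists Y => //; apply: crun_skip.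
- by move=> T1 T2 K rho X _ IH mu nu /IH [Y] KY YX; exists Y => //; apply: crun_seq.
- move=> C K a K1 rho X st KX IH [|b mu] nu /=.
    by move=> ->; exists (C :: K); [apply: crun_refl | apply: crun_next KX].
  by case=> -> /IH [Y] KY YX; exists Y => //; apply: crun_next KY.
Qed.

Lemma crun_cons_next K a nu X : crun K (a :: nu) X ->
  exists C K1 K2, [/\ crun K [::] (C :: K1), next C K1 a K2 & crun K2 nu X].
Proof.
move E: (a :: nu) => rho Krho; elim: Krho E => {K rho X} //.
- move=> K rho X _ IH /IH [C [K1 [K2 [r1 st r2]]]].
  by exists C, K1, K2; split=> //; apply: crun_skip.
- move=> T1 T2 K rho X _ IH /IH [C [K1 [K2 [r1 st r2]]]].
  by exists C, K1, K2; split=> //; apply: crun_seq.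
- move=> C K b K1 rho X st KX _ [-> ->]; exists C, K, K1; split=> //.
  exact: crun_refl.
Qed.

Lemma paths_split T mu a nu : paths T (mu ++ a :: nu) ->
  exists C K1 K2, [/\ crun [:: T] mu (C :: K1), next C K1 a K2
                    & crun K2 nu [::]].
Proof.
move=> /paths_crunE /crun_split [Y TY /crun_cons_next [C [K1 [K2 [YC st r]]]]].
exists C, K1, K2; split=> //; rewrite -[mu]cats0; exact: crun_trans YC.
Qed.

Lemma next_assign C K y f (l : L) (x : {ffun 'I_(arF f) -> V}) X :
  next C K (LAssign y l x) X -> C = Assign y l x /\ X = K.
Proof.
case: C => //=.
- by move=> [? [? []]].
- move=> y' f' l' x' [E ->]; split=> //.
  (* Turning the letter back into a schema avoids inverting an equation between dependent
     arguments. *)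
  pose g (b : letter) := if b is @Defs.LAssign _ _ _ _ _ _ y0 f0 l0 x0
    then Assign y0 l0 x0 else Skip.
  exact: (esym (congr1 g E)).
- by move=> ? ? [? [? []]].
- by move=> p l' x' T1 T2 [h [b []]].
- by move=> p l' x' T [h [b []]].
Qed.

(** The finitely many stacks met from [T :: K] while [T] is unfinished; they serve as the program
    points of [T]. The entry [Skip :: K] of a loop is the point just after its exit. *)
Fixpoint conts T K : seq config :=
  (T :: K) ::
  match T with
  | Seq T1 T2 => conts T1 (T2 :: K) ++ conts T2 K
  | @If _ _ _ _ _ _ _ _ _ T1 T2 => conts T1 K ++ conts T2 K
  | @While _ _ _ _ _ _ _ _ _ T1 => conts T1 (T :: K) ++ [:: Skip :: K]
  | _ => [::]
  end.

Lemma conts_head T K : In (T :: K) (conts T K).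
Proof. by case: T => *; left. Qed.

Lemma conts_phead C K h : phead C = Some h ->
  conts C K = (C :: K) :: conts (side C true) (ret C true K)
                ++ conts (side C false) (ret C false K).
Proof. by case: C. Qed.

Lemma conts_trans T K0 C K X :
  In (C :: K) (conts T K0) -> In X (conts C K) -> In X (conts T K0).
Proof.
elim: T K0 => [|y f l x|T1 IH1 T2 IH2|p l x T1 IH1 T2 IH2|q l y T IH] K0 /=;
  case=> [[<- <-]//|] //.
- by move/In_cat=> [/IH1|/IH2] XT /XT ?; right; apply/In_cat; [left|right].
- by move/In_cat=> [/IH1|/IH2] XT /XT ?; right; apply/In_cat; [left|right].
- move/In_cat=> [/IH XT /XT ?|]; first by right; apply/In_cat; left.
  case=> // -[<- <-] /= [<-|//]; right; apply/In_cat; right; by left.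
Qed.

Lemma conts_tail T K0 C K :
  In (C :: K) (conts T K0) -> K = K0 \/ In K (conts T K0).
Proof.
elim: T K0 => [|y f l x|T1 IH1 T2 IH2|p l x T1 IH1 T2 IH2|q l y T IH] K0 /=;
  case=> [[_ ->]|] //; try by left.
- move/In_cat=> [/IH1|/IH2] [->|KT].
  + by right; right; apply/In_cat; right; apply: conts_head.
  + by right; right; apply/In_cat; left.
  + by left.
  + by right; right; apply/In_cat; right.
- move/In_cat=> [/IH1|/IH2] [->|KT]; try by left.
  + by right; right; apply/In_cat; left.
  + by right; right; apply/In_cat; right.
- move/In_cat=> [/IH [->|KT]|[//|//]].
  + by right; left.
  + by right; right; apply/In_cat; left.
  + by case=> _ <-; left.
Qed.

Lemma crun_conts T K mu X :
  K = [::] \/ In K (conts T [::]) -> crun K mu X ->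
  X = [::] \/ In X (conts T [::]).
Proof.
move=> KT KX; elim: KX KT => {K mu X} //.
- move=> K mu X _ IH [//|KT]; apply: IH; exact: conts_tail KT.
- move=> T1 T2 K mu X _ IH [//|KT]; apply: IH; right; apply: conts_trans KT _.
  by right; apply/In_cat; left; apply: conts_head.
- move=> C K a K1 mu X st _ IH [//|KT]; apply: IH.
  case E: (phead C) => [h|]; last first.
    case: C st E KT => //=.
    + by move=> [? [? []]].
    + move=> y f l x [_ ->] _ /conts_tail //.
    + by move=> ? ? [? [? []]].
  have [b ->] : exists b, K1 = side C b :: ret C b K.
    by case: C st E {KT} => //= [p l x T1 T2|p l x T1] [? [b [_ _ ->]]] _; exists b.
  right; apply: conts_trans KT _; rewrite (conts_phead _ E); right.
  by apply/In_cat; case: b; [left|right]; apply: conts_head.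
Qed.

Lemma crun_In_conts T mu C K : crun [:: T] mu (C :: K) -> In (C :: K) (conts T [::]).
Proof. by move=> /(@crun_conts T) [|//|]; first by right; apply: conts_head. Qed.

(** Paths may choose every branch freely, so no program point is dead. *)
Lemma conts_crun T K X : In X (conts T K) -> exists mu, crun (T :: K) mu X.
Proof.
elim: T K => [|y f l x|T1 IH1 T2 IH2|p l x T1 IH1 T2 IH2|q l y T IH] K /=;
  case=> [<-|]; try by exists [::]; apply: crun_refl.
all: rewrite //=.
- move/In_cat=> [/IH1|/IH2] [mu r].
    by exists mu; apply: crun_seq.
  have [tau /(paths_crun (T2 :: K)) Tt] := paths_exists T1.
  by exists (tau ++ mu); apply/crun_seq/(crun_trans Tt).
- move/In_cat=> [/IH1|/IH2] [mu r].
  + exists (LPred l x true :: mu).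
    exact: (@crun_pred (If l x T1 T2) K (existT _ p (l, x)) true).
  + exists (LPred l x false :: mu).
    exact: (@crun_pred (If l x T1 T2) K (existT _ p (l, x)) false).
- move/In_cat=> [/IH [mu r]|[<-|//]].
  + exists (LPred l y true :: mu).
    exact: (@crun_pred (While l y T) K (existT _ q (l, y)) true).
  + exists [:: LPred l y false].
    apply: (@crun_pred (While l y T) K (existT _ q (l, y)) false) => //.
    exact: crun_refl.
Qed.

Lemma conts_sym T K0 C K x :
  In (C :: K) (conts T K0) -> head_sym C = Some x -> x \in lsyms T.
Proof.
elim: T K0 => [|y f l z|T1 IH1 T2 IH2|p l z T1 IH1 T2 IH2|q l z T IH] K0 /=;
  case=> [[<- _]/= [] //|] //.
- by move=> <-; rewrite inE.
- by move/In_cat=> [/IH1 h|/IH2 h] /h; rewrite mem_cat => ->; rewrite ?orbT.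
- by move=> <-; rewrite inE eqxx.
- by move/In_cat=> [/IH1 h|/IH2 h] /h; rewrite inE mem_cat => ->; rewrite ?orbT.
- by move=> <-; rewrite inE eqxx.
- move/In_cat=> [/IH h /h|[[<- _] //|//]].
  by rewrite inE => ->; rewrite orbT.
Qed.

(** As labels are distinct, a labelled symbol names one program point. A path found through a symbol
    can therefore be glued to any run that reaches this symbol. *)
Lemma conts_uniq T K0 C K C' K' x : uniq (lsyms T) ->
  In (C :: K) (conts T K0) -> In (C' :: K') (conts T K0) ->
  head_sym C = Some x -> head_sym C' = Some x -> C = C' /\ K = K'.
Proof.
elim: T K0 => [|y f l z|T1 IH1 T2 IH2|p l z T1 IH1 T2 IH2|q l z T IH] K0 /=.
- by move=> _ [[<- _]|//].
- by move=> _ [[<- <-]|//] [[<- <-]|//].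
- rewrite cat_uniq => /and3P[u1 /hasPn u12 u2] [[<- _] _ //|].
  move=> /In_cat[]CT [[<- _] //|] /In_cat[]CT' sC sC'.
  + exact: IH1 CT CT' sC sC'.
  + by have := u12 _ (conts_sym CT' sC'); rewrite (conts_sym CT sC).
  + by have := u12 _ (conts_sym CT sC); rewrite (conts_sym CT' sC').
  + exact: IH2 CT CT' sC sC'.
- rewrite mem_cat negb_or cat_uniq => /andP[/andP[n1 n2] /and3P[u1 /hasPn u12 u2]].
  move=> [[<- <-]|CT] [[<- <-]|CT'] //.
  + move=> [<-] sC'; case/In_cat: CT' => /conts_sym/(_ sC') h; first by rewrite h in n1.
    by rewrite h in n2.
  + move=> sC [E]; rewrite -E in sC; case/In_cat: CT => /conts_sym/(_ sC) h.
      by rewrite h in n1.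
    by rewrite h in n2.
  + case/In_cat: CT CT' => CT /In_cat[]CT' sC sC'.
    * exact: IH1 CT CT' sC sC'.
    * by have := u12 _ (conts_sym CT' sC'); rewrite (conts_sym CT sC).
    * by have := u12 _ (conts_sym CT sC); rewrite (conts_sym CT' sC').
    * exact: IH2 CT CT' sC sC'.
- move=> /andP[n1 u1] [[<- <-]|CT] [[<- <-]|CT'] //.
  + move=> [<-] sC'; case/In_cat: CT' => [/conts_sym/(_ sC') h|]; first by rewrite h in n1.
    by case=> // -[E _]; rewrite -E in sC'.
  + move=> sC [E]; rewrite -E in sC; case/In_cat: CT => [/conts_sym/(_ sC) h|].
      by rewrite h in n1.
    by case=> // -[E' _]; rewrite -E' in sC.
  + case/In_cat: CT => [CT|[[E _]|//]]; last by rewrite -E.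
    case/In_cat: CT' => [CT'|[[E _]|//]]; last by rewrite -E.
    exact: IH CT CT'.
Qed.

(** * Subschemas and their symbols *)

Lemma subschema_trans T1 T2 T3 :
  subschema T1 T2 -> subschema T2 T3 -> subschema T1 T3.
Proof.
move=> s12; elim: T3 => [|y f l x|U1 IH1 U2 IH2|p l x U1 IH1 U2 IH2|q l y U IH];
  case=> [<-//|] //.
- by case=> [/IH1|/IH2] ?; right; [left|right].
- by case=> [/IH1|/IH2] ?; right; [left|right].
- by move/IH; right.
Qed.

Lemma subschema_conts C T K0 : subschema C T -> exists K, In (C :: K) (conts T K0).
Proof.
elim: T K0 => [|y f l x|U1 IH1 U2 IH2|p l x U1 IH1 U2 IH2|q l y U IH] K0 /=;
  case=> [->|] //; try by exists K0; left.
- case=> [/(IH1 (U2 :: K0))|/(IH2 K0)] [K CK].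
    by exists K; right; apply/In_cat; left.
  by exists K; right; apply/In_cat; right.
- case=> [/(IH1 K0)|/(IH2 K0)] [K CK].
    by exists K; right; apply/In_cat; left.
  by exists K; right; apply/In_cat; right.
- by move=> /(IH (While l y U :: K0)) [K CK]; exists K; right; apply/In_cat; left.
Qed.

Lemma conts_subschema C T K0 K x :
  In (C :: K) (conts T K0) -> head_sym C = Some x -> subschema C T.
Proof.
move=> CT sC; elim: T K0 CT => [|y f l z|U1 IH1 U2 IH2|p l z U1 IH1 U2 IH2|q l z U IH] K0 /=;
  case=> [[<- _]|] //; try by left.
- by move/In_cat=> [/IH1|/IH2] ?; right; [left|right].
- by move/In_cat=> [/IH1|/IH2] ?; right; [left|right].
- move/In_cat=> [/IH|[[E _]|//]]; first by right.
  by rewrite -E in sC.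
Qed.

Lemma subschema_lsyms C T : subschema C T -> {subset lsyms C <= lsyms T}.
Proof.
elim: T => [|y f l x|U1 IH1 U2 IH2|p l x U1 IH1 U2 IH2|q l y U IH] /=;
  case=> [->//|] //.
- by case=> [/IH1 h|/IH2 h] x /h; rewrite mem_cat => ->; rewrite ?orbT.
- by case=> [/IH1 h|/IH2 h] z /h; rewrite inE mem_cat => ->; rewrite ?orbT.
- by move=> /IH h z /h; rewrite inE => ->; rewrite ?orbT.
Qed.

Lemma lsyms_subschema T x : x \in lsyms T ->
  exists2 C, subschema C T & head_sym C = Some x.
Proof.
elim: T => [|y f l z|U1 IH1 U2 IH2|p l z U1 IH1 U2 IH2|q l y U IH] //=.
- by rewrite inE => /eqP ->; exists (Assign y l z); [left|].
- by rewrite mem_cat => /orP[/IH1|/IH2] [C CT sC]; exists C => //; right; [left|right].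
- rewrite inE mem_cat => /or3P[/eqP->|/IH1 [C CT sC]|/IH2 [C CT sC]].
  + by exists (If l z U1 U2); [left|].
  + by exists C => //; right; left.
  + by exists C => //; right; right.
- rewrite inE => /orP[/eqP->|/IH [C CT sC]].
  + by exists (While l y U); [left|].
  + by exists C => //; right.
Qed.

Definition pname (x : lsym) : option P := if x is inr (p, _) then Some p else None.

Lemma preds_pmap T : preds T = pmap pname (lsyms T).
Proof.
elim: T => //= [T1 -> T2 ->|p l x T1 -> T2 ->|q l y T ->] //=; by rewrite pmap_cat.
Qed.

(** Used with [pname]: under predicate-linearity a predicate symbol occurs with a single label. *)
Lemma uniq_pmap_inj (A B : eqType) (g : A -> option B) (s : seq A) x y b :
  uniq (pmap g s) -> x \in s -> y \in s -> g x = Some b -> g y = Some b -> x = y.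
Proof.
have mem z : z \in s -> g z = Some b -> b \in pmap g s.
  by move=> zs gz; rewrite mem_pmap; apply/mapP; exists z.
elim: s mem => //= a s IH mem; case E: (g a) => [c|] /=; last first.
  move=> us; rewrite !inE => /predU1P[->|xs]; first by rewrite E.
  move=> /predU1P[->|ys]; first by rewrite E.
  by apply: IH => // z zs gz; rewrite mem_pmap; apply/mapP; exists z.
case/andP=> cs us; rewrite !inE => /predU1P[->|xs] /predU1P[->|ys] //.
- rewrite E => -[cb] gy; case/negP: cs; rewrite cb mem_pmap; apply/mapP.
  by exists y.
- move=> gx; rewrite E => -[cb]; case/negP: cs; rewrite cb mem_pmap; apply/mapP.
  by exists x.
- by apply: IH => // z zs gz; rewrite mem_pmap; apply/mapP; exists z.
Qed.

(** Assignments are recorded as subschemas because the condition on true and false parts speaks of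
    those; for tests the predicate symbol suffices. *)
Definition sound_letter T a : Prop :=
  match a with
  | @Defs.LAssign _ _ _ _ _ _ y f l x => subschema (Assign y l x) T
  | @Defs.LPred _ _ _ _ _ _ p l x _ => p \in preds T
  end.

Lemma paths_sound T tau a : paths T tau -> In a tau -> sound_letter T a.
Proof.
move=> Tt; elim: Tt => {T tau} //=.
- by move=> y f l x [<-|//]; left.
- move=> S1 S2 mu nu _ IH1 _ IH2 /In_cat [/IH1|/IH2]; case: a {IH1 IH2} => /=.
  + by move=> *; right; left.
  + by move=> ? ? ? ?; rewrite mem_cat => ->.
  + by move=> *; right; right.
  + by move=> ? ? ? ?; rewrite mem_cat => ->; rewrite orbT.
- move=> p l x T1 T2 mu _ IH [<-|/IH] /=; first by rewrite inE eqxx.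
  by case: a {IH} => /=[*|? ? ? ?]; [right; left | rewrite inE mem_cat => ->; rewrite orbT].
- move=> p l x T1 T2 mu _ IH [<-|/IH] /=; first by rewrite inE eqxx.
  by case: a {IH} => /=[*|? ? ? ?]; [right; right | rewrite inE mem_cat => ->; rewrite !orbT].
- by move=> q l y T [<-|//] /=; rewrite inE eqxx.
- move=> q l y T mu nu _ IH1 _ IH2 [<-|/In_cat [/IH1|/IH2 //]] /=.
    by rewrite inE eqxx.
  by case: a {IH1 IH2} => /=[*|? ? ? ?]; [right | rewrite inE => ->; rewrite orbT].
Qed.


(** * Predicate terms and interpretations *)

Definition atom : Type := {p : P & {ffun 'I_(arP p) -> term}}.

Definition value i (A : atom) : bool := i (projT1 A) (projT2 A).

Definition hatom d (h : header) : atom := existT _ (hname h) (veval d (hargs h)).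

Fixpoint tests d mu : seq (atom * bool) :=
  if mu is a :: mu' then
    match a with
    | @Defs.LPred _ _ _ _ _ _ p l x Z =>
        (existT _ p (veval d x), Z) :: tests (step d a) mu'
    | _ => tests (step d a) mu'
    end
  else [::].

Definition atoms mu : seq atom := map fst (tests (init arF) mu).

Definition follows i mu : Prop :=
  forall A b, In (A, b) (tests (init arF) mu) -> value i A = b.

Definition agree i j (s : seq atom) : Prop :=
  forall A, In A s -> value i A = value j A.

Definition finite_support i : Prop := exists s, forall A, value i A -> In A s.

Lemma run_cat mu nu : run (mu ++ nu) = foldl (@step _ _ _ _ _ _) (run mu) nu.
Proof. by rewrite /run foldl_cat. Qed.

Lemma tests_cat d mu nu :
  tests d (mu ++ nu) = tests d mu ++ tests (foldl (@step _ _ _ _ _ _) d mu) nu.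
Proof. by elim: mu d => //= -[y f l x|p l x b] mu IH d; rewrite IH. Qed.

Lemma atoms_cat mu nu : atoms (mu ++ nu) = atoms mu ++ map fst (tests (run mu) nu).
Proof. by rewrite /atoms tests_cat map_cat. Qed.

Lemma atoms_rcons_pred pi h b :
  atoms (rcons pi (hletter h b)) = atoms pi ++ [:: hatom (run pi) h].
Proof. by rewrite -cats1 atoms_cat. Qed.

Lemma atoms_catl pi tau A : In A (atoms pi) -> In A (atoms (pi ++ tau)).
Proof. by rewrite atoms_cat In_cat; left. Qed.

Lemma foldl_step_unassigned d nu w : ~~ has (assigns w) nu ->
  foldl (@step _ _ _ _ _ _) d nu w = d w.
Proof.
elim: nu d => //= -[y f l x|p l x b] nu IH d; rewrite ?negb_or /=; last exact: IH.
by move=> /andP[/negbTE yw /IH ->] /=; rewrite eq_sym yw.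
Qed.

Lemma run_unassigned pi nu w : ~~ has (assigns w) nu -> run (pi ++ nu) w = run pi w.
Proof. by move=> /foldl_step_unassigned h; rewrite run_cat h. Qed.

Lemma run_last_assigned pi y f (l : L) (x : {ffun 'I_(arF f) -> V}) nu :
  ~~ has (assigns y) nu ->
  run (pi ++ LAssign y l x :: nu) y = App (veval (run pi) x).
Proof.
by move=> nuy; rewrite -cat_rcons run_unassigned // /run foldl_rcons /= eqxx.
Qed.

Lemma run_rcons_pred pi h b : run (rcons pi (hletter h b)) = run pi.
Proof. by rewrite -cats1 run_cat. Qed.

Lemma assigned_split w tau : has (assigns w) tau ->
  exists tau1 f (l : L) (x : {ffun 'I_(arF f) -> V}) tau2,
    tau = tau1 ++ LAssign w l x :: tau2 /\ ~~ has (assigns w) tau2.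
Proof.
move=> /has_last_split [tau1 [[y f l x|p l x b] [tau2 [-> //= /eqP <- h]]]].
by exists tau1, f, l, x, tau2.
Qed.

Lemma tests_letter d tau A b : In (A, b) (tests d tau) ->
  exists l (x : {ffun 'I_(arP (projT1 A)) -> V}), In (LPred l x b) tau.
Proof.
elim: tau d => //= -[y f l x|p l x Z] tau IH d /=.
  by move=> /IH [l' [x' h]]; exists l', x'; right.
case=> [[<- <-]|/IH [l' [x' h]]]; first by exists l, x; left.
by exists l', x'; right.
Qed.

Lemma tests_preds T tau d A : paths T tau -> In A (map fst (tests d tau)) ->
  projT1 A \in preds T.
Proof.
move=> Tt /In_map [[A' b] /tests_letter /= [l [x h]] ->] /=.
exact: paths_sound Tt h.
Qed.

Lemma agree_follows i j mu : agree i j (atoms mu) -> follows j mu -> follows i mu.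
Proof.
move=> ag fo A b h; rewrite ag; first exact: fo.
by apply/In_map; exists (A, b).
Qed.

Lemma agree_refl i s : agree i i s.
Proof. by []. Qed.

Lemma agree_trans i j k s t :
  agree i j s -> agree j k t -> (forall A, In A t -> In A s) -> agree i k t.
Proof. by move=> ij jk ts A At; rewrite ij ?jk //; apply: ts. Qed.

Lemma follows_catl i pi tau : follows i (pi ++ tau) -> follows i pi.
Proof. by move=> fo A b h; apply: fo; rewrite tests_cat In_cat; left. Qed.

Lemma follows_rcons_pred i pi h b : follows i (rcons pi (hletter h b)) <->
  follows i pi /\ value i (hatom (run pi) h) = b.
Proof.
rewrite -cats1; split=> [fo|[fo v] A c].
  split; first exact: follows_catl fo.
  by apply: fo; rewrite tests_cat In_cat; right; left.
by rewrite tests_cat In_cat => -[/fo //|[[<- <-]|//]].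
Qed.

Lemma follows_rcons_assign i pi y f (l : L) (x : {ffun 'I_(arF f) -> V}) :
  follows i pi -> follows i (rcons pi (LAssign y l x)).
Proof. by move=> fo A b; rewrite -cats1 tests_cat In_cat => -[/fo|[]]. Qed.

(** Predicate terms are compared through classical decidability, as [term] is a plain type. *)
Definition upd i (A : atom) (b : bool) : interp :=
  fun p t => if `[< existT _ p t = A >] then b else i p t.

(** The other half of a couple is always taken in this form, so that only one interpretation has to
    be carried along. *)
Definition flip (A : atom) i : interp :=
  fun p t => `[< existT _ p t = A >] (+) i p t.

Lemma atomK (A : atom) : existT _ (projT1 A) (projT2 A) = A.
Proof. by case: A. Qed.

Lemma value_upd_eq i A b : value (upd i A b) A = b.
Proof. by rewrite /value /upd atomK asboolT. Qed.

Lemma value_upd_neq i A b A' : A' <> A -> value (upd i A b) A' = value i A'.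
Proof. by move=> ne; rewrite /value /upd atomK asboolF. Qed.

Lemma value_flip A i A' : value (flip A i) A' = `[< A' = A >] (+) value i A'.
Proof. by rewrite /value /flip atomK. Qed.

Lemma agree_upd i A b s : ~ In A s -> agree (upd i A b) i s.
Proof. by move=> As A' A's; apply: value_upd_neq => E; rewrite E in A's. Qed.

Lemma agree_flip A i j s : agree i j s -> agree (flip A i) (flip A j) s.
Proof. by move=> ij A' A's; rewrite !value_flip ij. Qed.

Lemma finite_upd i A b : finite_support i -> finite_support (upd i A b).
Proof.
case=> s is_; exists (A :: s) => A'; have [->|ne] := pselect (A' = A).
  by left.
by rewrite value_upd_neq // => /is_; right.
Qed.

Lemma finite_flip A i : finite_support i -> finite_support (flip A i).
Proof.
case=> s is_; exists (A :: s) => A'; rewrite value_flip.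
by case: asboolP => [->|_] /=; [left | move/is_; right].
Qed.

Lemma follows_upd_rcons i pi h b :
  follows i pi -> ~ In (hatom (run pi) h) (atoms pi) ->
  follows (upd i (hatom (run pi) h) b) (rcons pi (hletter h b)).
Proof.
move=> fo fr; apply/follows_rcons_pred; split; last exact: value_upd_eq.
by apply: agree_follows fo; apply: agree_upd.
Qed.

Lemma prefix_of_rcons mu a (w : word V L arF arP) :
  prefix_of (rcons mu a) w -> prefix_of mu w.
Proof.
case: w => [s [nu ->]|h] /=; first by exists (a :: nu); rewrite cat_rcons.
by rewrite size_rcons mkseqS => /rcons_inj [].
Qed.

Lemma execution_follows S i (w : word V L arF arP) mu :
  execution S i w -> prefix_of mu w -> follows i mu.
Proof.
move=> [_ _ ex]; elim/last_ind: mu => [_ A b []|mu a IH pw].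
have fo := IH (prefix_of_rcons pw).
case: a pw => [y f l x|p l x Z] pw; first exact: follows_rcons_assign.
apply/(@follows_rcons_pred i mu (existT _ p (l, x)) Z); split=> //.
exact: ex pw.
Qed.

Lemma crun_execution S i s : crun [:: S] s [::] -> follows i s -> execution S i (Fin s).
Proof.
move=> /paths_crunE Ss fo; split=> [mu [nu E]|_ [<-]//|sigma p l x Z [nu E]].
  by exists nu; rewrite -E.
apply: (fo (existT _ p (veval (run sigma) x))).
by rewrite E -cats1 -catA tests_cat In_cat; right; left.
Qed.

(** * Consequences of freeness and liberality *)

Section Free.

Variable S : schema.
Hypothesis freeS : free S.

Lemma follows_exists pi K : crun [:: S] pi K -> exists i, follows i pi.
Proof.
move=> /crun_pre /freeS [i [w [ex pw]]]; exists i.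
exact: execution_follows ex pw.
Qed.

(** Had the predicate term been met before with outcome [b], the path continued by the outcome
    opposite to [b] could be followed by no interpretation. *)
Lemma fresh_test pi C K h : crun [:: S] pi (C :: K) -> phead C = Some h ->
  ~ In (hatom (run pi) h) (atoms pi).
Proof.
move=> r hC /In_map [[A b] Ab /= E].
have r' := crun_rcons_next r (next_pred K (~~ b) hC).
have [i /follows_rcons_pred [fo]] := follows_exists r'.
by rewrite E (fo _ _ Ab); case: (b).
Qed.

(** Take the interpretation that is true exactly at the predicate terms that the path tests as
    true. *)
Lemma finite_follows pi K : crun [:: S] pi K ->
  exists2 i, finite_support i & follows i pi.
Proof.
move=> /follows_exists [j fo].
exists (fun p t => `[< In (existT _ p t, true) (tests (init arF) pi) >]).
  exists (atoms pi) => A; rewrite /value atomK => /asboolP h.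
  by apply/In_map; exists (A, true).
move=> A b Ab; rewrite /value atomK; case: asboolP => [h|h].
  by rewrite -(fo _ _ Ab) (fo _ _ h).
by case: b Ab h.
Qed.

(* Every test that succeeds uses up one element of the finite support. *)
Lemma run_finite T K pi i : crun [:: S] pi (T :: K) -> follows i pi ->
  finite_support i -> exists2 tau, paths T tau & follows i (pi ++ tau).
Proof.
elim: T K pi => [|y f l x|T1 IH1 T2 IH2|p l x T1 IH1 T2 IH2|q l y T IH] K pi r fo fin.
- by exists [::]; [apply: paths_skip | rewrite cats0].
- exists [:: LAssign y l x]; first exact: paths_assign.
  by rewrite cats1; apply: follows_rcons_assign.
- have r1 : crun [:: S] pi (T1 :: T2 :: K).
    rewrite -[pi]cats0; apply: crun_trans r _; exact/crun_seq/crun_refl.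
  have [t1 p1 fo1] := IH1 _ _ r1 fo fin.
  have [t2 p2 fo2] := IH2 _ _ (crun_trans r1 (paths_crun _ p1)) fo1 fin.
  by exists (t1 ++ t2); [apply: paths_seq | rewrite catA].
- pose h : header := existT _ p (l, x); set b := value i (hatom (run pi) h).
  have foA : follows i (rcons pi (hletter h b)) by apply/follows_rcons_pred.
  have := crun_rcons_next r (@next_pred (If l x T1 T2) K h b erefl).
  move: foA; case: b => foA rA.
    have [t pt fot] := IH1 _ _ rA foA fin.
    by exists (LPred l x true :: t); [apply: paths_if_true | rewrite -cat_rcons].
  have [t pt fot] := IH2 _ _ rA foA fin.
  by exists (LPred l x false :: t); [apply: paths_if_false | rewrite -cat_rcons].
- have [s is_] := fin; pose h : header := existT _ q (l, y).
  (* Induction on a list [s] that covers the true predicate terms not yet met; a successful test,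
     being fresh, removes one of its entries. *)
  have {is_} : forall A, value i A -> In A (atoms pi) \/ In A s.
    by move=> A /is_; right.
  have [n] := ubnP (size s); elim: n s pi r fo => // n IHn s pi r fo sn is_.
  have frA := fresh_test r (erefl : phead (While l y T) = Some h).
  have rA := crun_rcons_next r (@next_pred (While l y T) K h true erefl).
  case vA: (value i (hatom (run pi) h)); last first.
    exists [:: LPred l y false]; first exact: paths_while_false.
    by rewrite cats1; apply/(follows_rcons_pred i pi h).
  case: (is_ _ vA) => [/frA //|/(@In_splitr _ _ _) [s1 [s2 Es]]].
  have foA : follows i (rcons pi (hletter h true)) by apply/follows_rcons_pred.
  have [t pt fot] := IH _ _ rA foA fin.
  have rt := crun_trans rA (paths_crun _ pt).
  have [||t' pt' fot'] := IHn (s1 ++ s2) _ rt fot.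
  + by move: sn; rewrite Es !size_cat /= addnS ltnS.
  + move=> B /is_; rewrite Es atoms_cat atoms_rcons_pred !In_cat /=.
    by case=> [?|[?|[<-|?]]]; [left; left; left | right; left | left; left; right; left | right; right].
  exists (LPred l y true :: t ++ t'); first exact: paths_while_true.
  by rewrite -cat_rcons catA.
Qed.

Hypothesis liberalS : liberal S.

(** The value of [v] is either still the initial variable, hence no application, or the result of an
    earlier assignment on the same path, to which liberality applies. *)
Lemma new_value pi t1 y f (l : L) (x : {ffun 'I_(arF f) -> V}) t2 K v :
  crun [:: S] (pi ++ t1 ++ LAssign y l x :: t2) K -> ~~ has (assigns y) t2 ->
  run pi v <> run (pi ++ t1 ++ LAssign y l x :: t2) y.
Proof.
rewrite catA => r nt; rewrite run_last_assigned //.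
move: r; rewrite -cat_rcons => /crun_split [Y r _].
case: (boolP (has (assigns v) pi)) => [/assigned_split|nv]; last first.
  by rewrite -[pi]cat0s run_unassigned.
move=> [pi1 [g [m [b [pi2 [E n2]]]]]] eqv.
have [i [w [ex pw]]] := freeS (crun_pre r).
have := liberalS (mu := pi1) (v := v) (l := m) (a := b) (nu := pi2 ++ t1)
  (z := y) (m := l) (b := x) ex.
rewrite catA cat_rcons -E => /(_ pw); apply.
rewrite -[rcons pi1 _]cats1 run_last_assigned // -cats1 run_last_assigned //.
by rewrite -eqv E run_last_assigned.
Qed.

End Free.

(** * Levels of need and reachability of uses *)

Section Need.

Variables (S : schema) (u : V).
Hypothesis labS : well_labelled S.

(** Stages of the least fixed point [need]. They are cumulative and empty at 0, so [level c.+1]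
    without [level c] means rank exactly [c.+1]. *)
Fixpoint level (r : nat) (x : lsym) : Prop :=
  if r is r'.+1 then
    [\/ level r' x,
        exists f l, x = inl (f, l) /\ final_dep S f l u,
        exists f l y, [/\ x = inl (f, l), level r' y & data_dep S f l y]
      | exists p l y, [/\ x = inr (p, l), level r' y & encloses S p l y]]
  else False.

Lemma level_le r r' x : r <= r' -> level r x -> level r' x.
Proof.
move=> /subnKC <-; elim: (r' - r) => [|k IH]; first by rewrite addn0.
by rewrite addnS => /IH; constructor 1.
Qed.

Lemma need_level x : need S u x -> exists r, level r x.
Proof.
elim=> {x} [f l fd|f l x _ [r rx] fd|p l x _ [r rx] en].
- by exists 1; constructor 2; exists f, l.
- by exists r.+1; constructor 3; exists f, l, x.
- by exists r.+1; constructor 4; exists p, l, x.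
Qed.

Lemma level_need r x : level r x -> need S u x.
Proof.
elim: r x => //= r IH x [/IH //|[f [l [-> fd]]]|[f [l [y [-> /IH ny fd]]]]|].
- exact: need_final.
- exact: need_data ny fd.
- move=> [p [l [y [-> /IH ny en]]]]; exact: need_control ny en.
Qed.

Definition has_level r T : Prop := exists2 x, x \in lsyms T & level r x.

Lemma has_level_le r r' T : r <= r' -> has_level r T -> has_level r' T.
Proof. by move=> rr' [x xT /(level_le rr') xr]; exists x. Qed.

Lemma has_level_sub r T T' : {subset lsyms T <= lsyms T'} ->
  has_level r T -> has_level r T'.
Proof. by move=> TT' [x /TT' xT xr]; exists x. Qed.

Lemma encloses_phead p l x : encloses S p l x ->
  exists C h b, [/\ subschema C S, phead C = Some h, hsym h = inr (p, l)
                  & x \in lsyms (side C b)].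
Proof.
case=> [[v [T1 [T2 [sub [xT|xT]]]]]|[v [T [sub xT]]]].
- by exists (If l v T1 T2), (existT _ p (l, v)), true.
- by exists (If l v T1 T2), (existT _ p (l, v)), false.
- by exists (While l v T), (existT _ p (l, v)), true.
Qed.

Lemma subschema_uniq C C' x : subschema C S -> subschema C' S ->
  head_sym C = Some x -> head_sym C' = Some x -> C = C'.
Proof.
move=> /(subschema_conts [::]) [K CK] /(subschema_conts [::]) [K' CK'] sC sC'.
by have [] := conts_uniq labS CK CK' sC sC'.
Qed.

(** The least rank in [C] is attained by a function symbol: a predicate symbol gets its rank from a
    symbol of smaller rank under its control, and by distinct labels that symbol also lies in
    [C]. *)
Lemma has_level_min C h r : subschema C S -> phead C = Some h -> has_level r C ->
  exists c b f l, [/\ c < r, ~ has_level c C, inl (f, l) \in lsyms (side C b),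
                      level c.+1 (inl (f, l)) & ~ level c (inl (f, l))].
Proof.
move=> CS hC hr.
have exr : exists r', `[< has_level r' C >] by exists r; apply/asboolP.
case: (ex_minnP exr) => -[|c] /asboolP [x xC xc] cmin; first by [].
have cr : c < r by apply: cmin; apply/asboolP.
have nc : ~ has_level c C.
  by move=> /asboolP /cmin; rewrite ltnn.
have nx : ~ level c x by move=> cx; apply: nc; exists x.
case: x xC xc nx => [[f l]|[p l]] xC xc nx.
  move: xC; rewrite (lsyms_phead hC) inE /= mem_cat => /orP[] xC;
    by [exists c, true, f, l | exists c, false, f, l].
exfalso; case: xc => [//|[? [? []]]//|[? [? [? []]]]//|[q [m [y [[Ep El] cy en]]]]].
rewrite -{}Ep -{}El in en.
have [C1 [h1 [b [C1S hC1 s1 yC1]]]] := encloses_phead en.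
have [C2 C2C s2] := lsyms_subschema xC.
have E : C1 = C2.
  apply: subschema_uniq C1S (subschema_trans C2C CS) _ s2.
  by rewrite (head_sym_phead hC1) s1.
apply: nc; exists y => //; apply: (subschema_lsyms C2C); rewrite -E.
exact: sub_lsyms_side hC1 _ yC1.
Qed.

(* [reach r w n K]: within [n] steps from [K], the current value of [w] can get
   to a use of level [r], or to the end of the program if [w] is [u]. *)
Fixpoint reach (r : nat) (w : V) (n : nat) K : Prop :=
  if n is n'.+1 then
    match K with
    | [::] => w = u
    | C :: K' =>
        match C with
        | Defs.Skip => reach r w n' K'
        | @Defs.Assign _ _ _ _ _ _ y f l x =>
            (level r (inl (f, l)) /\ w \in codom x) \/ (y <> w /\ reach r w n' K')
        | Seq T1 T2 => reach r w n' (T1 :: T2 :: K')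
        | _ => exists2 h, phead C = Some h &
            (level r (hsym h) /\ w \in codom (hargs h)) \/
            (exists b, reach r w n' (side C b :: ret C b K'))
        end
    end
  else False.

Lemma reach_phead r w n C K h : phead C = Some h ->
  reach r w n.+1 (C :: K) <->
  (level r (hsym h) /\ w \in codom (hargs h)) \/
  (exists b, reach r w n (side C b :: ret C b K)).
Proof.
by case: C => //= [p l x T1 T2|p l x T] [<-]; split;
  [case=> h' [<-] | eexists; first reflexivity | case=> h' [<-]
  | eexists; first reflexivity].
Qed.

Lemma reachS r w n K : reach r w n K -> reach r w n.+1 K.
Proof.
elim: n K => // n IH [//|C K]; case E: (phead C) => [h|]; last first.
  case: C E => //.
  - by move=> _ /IH.
  - by move=> y f l x _ [?|[? /IH ?]]; [left|right].
  - by move=> T1 T2 _ /IH.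
move/(reach_phead _ _ _ _ E)=> [?|[b /IH ?]]; apply/(reach_phead _ _ _ _ E).
  by left.
by right; exists b.
Qed.

Lemma reach_le r w n n' K : n <= n' -> reach r w n K -> reach r w n' K.
Proof.
move=> /subnKC <-; elim: (n' - n) => [|k IH]; first by rewrite addn0.
by rewrite addnS => /IH /reachS.
Qed.

(** The use cannot be in [T], so the way to it goes past the end of [T]. The induction is on [n]
    since a loop reappears on the stack below its body. *)
Lemma reach_skip r w n T K : ~ has_level r T -> reach r w n (T :: K) ->
  exists2 n', n' < n & reach r w n' K.
Proof.
have [m] := ubnP n; elim: m n T K => // m IH [//|n] T K /ltnSE nm nT.
case E: (phead T) => [h|].
  move=> /(reach_phead _ _ _ _ E) [[lh _]|[b]].
    case: nT; exists (hsym h) => //.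
    by rewrite (lsyms_phead E) inE eqxx.
  have ns : ~ has_level r (side T b).
    by move=> hs; apply: nT; apply: has_level_sub hs; apply: sub_lsyms_side E.
  move=> /(IH _ _ _ nm ns) [n1 n1n].
  have [->|->] : ret T b K = K \/ ret T b K = T :: K.
  - by case: T {E nT ns} => * /=; case: (b); auto.
  - by exists n1 => //; apply: ltnW.
  - move=> /(IH _ _ _ (ltn_trans n1n nm) nT) [n2 n2n1 rK]; exists n2 => //.
    exact: ltn_trans n2n1 (leq_trans n1n (leqnSn n)).
case: T E nT => //.
- by move=> _ _ rK; exists n.
- move=> y f l x _ nT [[lf _]|[_ rK]]; last by exists n.
  by case: nT; exists (inl (f, l)) => //=; rewrite inE.
- move=> T1 T2 _ nT /= /(IH _ _ _ nm) [|n1 n1n].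
    by move=> h; apply: nT; apply: has_level_sub h => z /=; rewrite mem_cat => ->.
  move=> /(IH _ _ _ (ltn_trans n1n nm)) [|n2 n2n1 rK].
    by move=> h; apply: nT; apply: has_level_sub h => z /=; rewrite mem_cat => ->; rewrite orbT.
  by exists n2 => //; exact: ltn_trans n2n1 (leq_trans n1n (leqnSn n)).
Qed.

(** From any point inside [T] the way to the use passes the end of [T]. So if [n] is least for [K],
    no point of [T] gets to the use within [n] steps. *)
Lemma reach_conts r w n T K X : ~ has_level r T -> In X (conts T K) ->
  reach r w n X -> exists2 n', n' < n & reach r w n' K.
Proof.
elim: T K n => [|y f l x|T1 IH1 T2 IH2|p l x T1 IH1 T2 IH2|q l y T IH] K n nT /=;
  (case=> [<- h|]; first exact: reach_skip nT h); rewrite //=.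
- have n1 : ~ has_level r T1.
    by move=> h; apply: nT; apply: has_level_sub h => z /=; rewrite mem_cat => ->.
  have n2 : ~ has_level r T2.
    by move=> h; apply: nT; apply: has_level_sub h => z /=; rewrite mem_cat => ->; rewrite orbT.
  move/In_cat=> [XT|XT h]; last exact: IH2 XT h.
  move=> /(IH1 _ _ n1 XT) [m mn /(reach_skip n2) [m' m'm rK]].
  by exists m' => //; apply: ltn_trans mn.
- have n1 : ~ has_level r T1.
    by move=> h; apply: nT; apply: has_level_sub h => z /=; rewrite inE mem_cat => ->; rewrite orbT.
  have n2 : ~ has_level r T2.
    by move=> h; apply: nT; apply: has_level_sub h => z /=; rewrite inE mem_cat => ->; rewrite !orbT.
  by move/In_cat=> [XT h|XT h]; [apply: IH1 XT h | apply: IH2 XT h].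
- have n1 : ~ has_level r T.
    by move=> h; apply: nT; apply: has_level_sub h => z /=; rewrite inE => ->; rewrite orbT.
  move/In_cat=> [XT|[<-|//] h].
    move=> /(IH _ _ n1 XT) [m mn /(reach_skip nT) [m' m'm rK]].
    by exists m' => //; apply: ltn_trans mn.
  by case: n h => // n h; exists n.
Qed.

Lemma crun_reach r w K nu X n : crun K nu X -> ~~ has (assigns w) nu ->
  reach r w n X -> exists n', reach r w n' K.
Proof.
elim=> {K nu X}.
- by move=> K _ h; exists n.
- by move=> K nu X _ IH nw /(IH nw) [n' h]; exists n'.+1.
- by move=> T1 T2 K nu X _ IH nw /(IH nw) [n' h]; exists n'.+1.
- move=> C K a K1 nu X st _ IH /=; rewrite negb_or => /andP[aw nw] /(IH nw) [n' h].
  exists n'.+1; case: C st.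
  + by move=> [? [? []]].
  + move=> y f l x [Ea E]; right; rewrite Ea /= in aw; rewrite -E.
    by split=> //; apply/eqP.
  + by move=> ? ? [? [? []]].
  + move=> p l x T1 T2 [h' [b [hC _ E]]]; apply/(reach_phead _ _ _ _ hC).
    by right; exists b; rewrite -E.
  + move=> p l x T [h' [b [hC _ E]]]; apply/(reach_phead _ _ _ _ hC).
    by right; exists b; rewrite -E.
Qed.

Lemma use_reach r w C K a X : next C K a X -> level r (sym_of a) ->
  references w a -> reach r w 1 (C :: K).
Proof.
case: C.
- by move=> [? [? []]].
- by move=> y f l x [-> _] /= lf wx; left.
- by move=> ? ? [? [? []]].
- move=> p l x T1 T2 [h [b [hC -> _]]] lh wh.
  by apply/(reach_phead _ _ _ _ hC); left.
- move=> p l x T [h [b [hC -> _]]] lh wh.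
  by apply/(reach_phead _ _ _ _ hC); left.
Qed.

Lemma assign_uniq y f (l : L) (x x' : {ffun 'I_(arF f) -> V}) K y' K' :
  In (Assign y l x :: K) (conts S [::]) ->
  In (Assign y' l x' :: K') (conts S [::]) -> y' = y /\ K' = K.
Proof.
move=> c1 c2; have [E ->] := conts_uniq labS c1 c2 erefl erefl; split=> //.
pose g C := if C is @Defs.Assign _ _ _ _ _ _ z _ _ _ then z else y.
by have := congr1 g E.
Qed.

(** The last rule of a shortest derivation gives a path from an assignment by [f^(l)] to a use of
    level [c] or to the end. Its part behind the assignment starts at [K], because the labelled
    symbol fixes the stack. *)
Lemma level_reach c y f (l : L) (x : {ffun 'I_(arF f) -> V}) K :
  In (Assign y l x :: K) (conts S [::]) ->
  level c.+1 (inl (f, l)) -> ~ level c (inl (f, l)) ->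
  exists n, reach c y n K.
Proof.
move=> cf [//|[g [m [[Ef El] fd]]]|[g [m [z [[Ef El] lz dd]]]]|[? [? [? []]]//]] _.
- subst g m; move: fd => [mu [b [nu [/paths_split]]]].
  move=> [C [K1 [K2 [r1 /next_assign [E ->] r2]]]] nw; rewrite {}E in r1.
  have [Ey EK] := assign_uniq cf (crun_In_conts r1).
  by rewrite -Ey -EK; apply: (crun_reach (n := 1) r2 nw).
- subst g m; move: dd => [mu [v [b [nu [a [mu' [/paths_split]]]]]]].
  move=> [C [K1 [K2 [r1 /next_assign [E ->] r2]]]] sa nw ra; rewrite {}E in r1.
  have [Ey EK] := assign_uniq cf (crun_In_conts r1).
  rewrite -{}Ey -{}EK.
  have [Y r3 /crun_cons_next [C1 [K3 [K4 [r4 st _]]]]] := crun_split r2.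
  apply: (crun_reach (n := 1) (crun_trans r3 r4)); first by rewrite cats0.
  by apply: use_reach st _ ra; rewrite sa.
Qed.

Lemma reach_use r w n K : reach r w n K -> exists nu, ~~ has (assigns w) nu /\
  ((w = u /\ crun K nu [::]) \/
   exists a rho, [/\ crun K (nu ++ a :: rho) [::], level r (sym_of a)
                   & references w a]).
Proof.
elim: n K => // n IH [|C K].
  by move=> /= ->; exists [::]; split=> //; left; split=> //; apply: crun_refl.
case E: (phead C) => [h|].
  move/(reach_phead _ _ _ _ E)=> [[lh wh]|[b /IH [nu [nw]]]].
    exists [::]; split=> //; right.
    have [rho r0] := crun_complete (side C true :: ret C true K).
    by exists (hletter h true), rho; split=> //; apply: crun_pred r0.
  case=> [[wu r0]|[a [rho [r0 la wa]]]]; exists (hletter h b :: nu).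
    by split=> //; left; split=> //; apply: crun_pred r0.
  by split=> //; right; exists a, rho; split=> //; apply: crun_pred r0.
case: C E => //.
- move=> _ /IH [nu [nw]].
  case=> [[wu r0]|[a [rho [r0 la wa]]]]; exists nu; split=> //; [left|right].
    by split=> //; apply: crun_skip.
  by exists a, rho; split=> //; apply: crun_skip.
- move=> y f l x _ [[lf wx]|[yw /IH [nu [nw]]]].
    exists [::]; split=> //; right; have [rho r0] := crun_complete K.
    by exists (LAssign y l x), rho; split=> //; apply: crun_next r0.
  case=> [[wu r0]|[a [rho [r0 la wa]]]]; exists (LAssign y l x :: nu);
    (split; first by rewrite /= negb_or nw andbT; apply/eqP); [left|right].
    by split=> //; apply: crun_next r0.
  by exists a, rho; split=> //; apply: crun_next r0.
- move=> T1 T2 _ /IH [nu [nw]].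
  case=> [[wu r0]|[a [rho [r0 la wa]]]]; exists nu; split=> //; [left|right].
    by split=> //; apply: crun_seq.
  by exists a, rho; split=> //; apply: crun_seq.
Qed.

(** Converse direction to [level_reach]: the run and the way to the use are joined into one path
    witnessing a dependence. *)
Lemma reach_level c w f (l : L) (x : {ffun 'I_(arF f) -> V}) pi tau n K :
  crun [:: S] (pi ++ LAssign w l x :: tau) K -> ~~ has (assigns w) tau ->
  reach c w n K -> level c.+1 (inl (f, l)).
Proof.
move=> r0 nt /reach_use [nu [nw]] [[wu r1]|[a [rho [r1 la wa]]]].
  constructor 2; exists f, l; split=> //; rewrite -wu.
  exists pi, x, (tau ++ nu); rewrite has_cat negb_or nt nw; split=> //.
  by apply/paths_crunE; have := crun_trans r0 r1; rewrite -catA.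
constructor 3; exists f, l, (sym_of a); split=> //.
exists pi, w, x, (tau ++ nu), a, rho; rewrite has_cat negb_or nt nw; split=> //.
by apply/paths_crunE; have := crun_trans r0 r1; rewrite -!catA.
Qed.

(* A last assignment to [w] inside [T] would be of level [c.+1]. *)
Lemma low_level_unassigned c w T K pi tau n :
  crun [:: S] pi (T :: K) -> paths T tau -> ~ has_level c.+1 T ->
  reach c w n K -> ~~ has (assigns w) tau.
Proof.
move=> r0 pt nT rK; apply/negP => /assigned_split [t1 [f [l [x [t2 [E n2]]]]]].
apply: nT; exists (inl (f, l)).
  have /(paths_sound pt) /= /subschema_lsyms : In (LAssign w l x) tau.
    by rewrite E; apply/In_cat; right; left.
  by apply; rewrite inE.
apply: (reach_level (pi := pi ++ t1) (x := x) _ n2 rK).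
by rewrite -catA -E; apply: crun_trans (paths_crun _ pt).
Qed.

(** * Steering executions *)

Hypothesis linS : predicate_linear S.
Hypothesis freeS : free S.
Hypothesis liberalS : liberal S.
Hypothesis disjS : forall p k c T1 T2, subschema (@If _ _ _ _ _ _ p k c T1 T2) S ->
  forall f y l x z m b,
    subschema (@Defs.Assign _ _ _ _ _ _ y f l x) T1 ->
    subschema (@Defs.Assign _ _ _ _ _ _ z f m b) T2 -> y <> z.

Definition contested c (q : P) : Prop :=
  exists C K h, [/\ In (C :: K) (conts S [::]), phead C = Some h, hname h = q
                  & has_level c C].

(** [Z] collects the predicate terms met by the other run. A test reached inside [T] is fresh; if
    its predicate is contested, its predicate term is then outside [Z], and the outcome can be set
    without disturbing the other run. *)
Definition fresh_for c T pi (Z : seq atom) : Prop :=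
  forall A, In A Z -> projT1 A \in preds T -> contested c (projT1 A) ->
  In A (atoms pi).

Lemma fresh_forW c T T' pi tau Z : {subset preds T' <= preds T} ->
  fresh_for c T pi Z -> fresh_for c T' (pi ++ tau) Z.
Proof. by move=> TT' fr A AZ /TT' AT cA; apply/atoms_catl/fr. Qed.

Lemma steer c T Z pi C K h i b :
  crun [:: S] pi (C :: K) -> phead C = Some h -> follows i pi ->
  finite_support i -> fresh_for c T pi Z -> hname h \in preds T ->
  has_level c C ->
  exists i', [/\ crun [:: S] (rcons pi (hletter h b)) (side C b :: ret C b K),
                 follows i' (rcons pi (hletter h b)), finite_support i'
               & agree i' i (atoms pi ++ Z)].
Proof.
move=> r hC fo fin fr hT lC; have frA := fresh_test freeS r hC.
exists (upd i (hatom (run pi) h) b); split.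
- exact: crun_rcons_next r (next_pred _ _ hC).
- exact: follows_upd_rcons.
- exact: finite_upd.
apply: agree_upd => /In_cat [//|AZ]; apply: frA; apply: fr AZ hT _.
by exists C, K, h; split=> //; apply: crun_In_conts r.
Qed.

Lemma hname_preds C h : phead C = Some h -> hname h \in preds C.
Proof. by move=> /preds_phead ->; rewrite inE eqxx. Qed.

Lemma crun_seq1 pi T1 T2 K : crun [:: S] pi (Seq T1 T2 :: K) ->
  crun [:: S] pi (T1 :: T2 :: K).
Proof.
move=> r; rewrite -[pi]cats0; apply: crun_trans r _; exact/crun_seq/crun_refl.
Qed.

Lemma paths_If p (l : L) (x : {ffun 'I_(arP p) -> V}) T1 T2 b tau :
  paths (side (If l x T1 T2) b) tau ->
  paths (If l x T1 T2) (LPred l x b :: tau).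
Proof. by case: b; [apply: paths_if_true | apply: paths_if_false]. Qed.

Lemma agree_catW i1 i2 i3 pi tau Z :
  agree i1 i2 (atoms (pi ++ tau) ++ Z) -> agree i2 i3 (atoms pi ++ Z) ->
  agree i1 i3 (atoms pi ++ Z).
Proof.
move=> a1 a2; apply: agree_trans a1 a2 _ => A; rewrite !In_cat.
by case=> [/(@atoms_catl _ tau)|]; [left|right].
Qed.

(* Tests inside parts of level [c.+1] are steered, the others do not matter. *)
Lemma avoid c w T K pi i Z n :
  crun [:: S] pi (T :: K) -> follows i pi -> finite_support i ->
  ~ has_level c T -> reach c w n (T :: K) -> fresh_for c.+1 T pi Z ->
  exists i' tau, [/\ paths T tau, follows i' (pi ++ tau), finite_support i',
    agree i' i (atoms pi ++ Z)
    & ~~ has (assigns w) tau /\ exists n', reach c w n' K].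
Proof.
(* A part without symbols of level [c.+1] may be crossed by any terminating path. *)
have dontcare T' K' pi' i' n' : crun [:: S] pi' (T' :: K') -> follows i' pi' ->
    finite_support i' -> ~ has_level c T' -> reach c w n' (T' :: K') ->
    ~ has_level c.+1 T' ->
    exists i'' tau, [/\ paths T' tau, follows i'' (pi' ++ tau),
      finite_support i'', agree i'' i' (atoms pi' ++ Z)
      & ~~ has (assigns w) tau /\ exists n'', reach c w n'' K'].
  move=> r fo fin nT rK nT'; have [tau pt fot] := run_finite freeS r fo fin.
  have [m _ rm] := reach_skip nT rK.
  exists i', tau; split=> //; split; last by exists m.
  exact: low_level_unassigned r pt nT' rm.
elim: T K pi i n => [|y f l x|T1 IH1 T2 IH2|p l x T1 IH1 T2 IH2|q l y T IH]
  K pi i n r fo fin nT rK fr.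
- exists i, [::]; rewrite cats0; split=> //; first exact: paths_skip.
  by split=> //; case: n rK => // n rK; exists n.
- case: n rK => // n [[lf _]|[yw rK]].
    by case: nT; exists (inl (f, l)) => //=; rewrite inE.
  exists i, [:: LAssign y l x]; rewrite cats1; split=> //.
  + exact: paths_assign.
  + exact: follows_rcons_assign.
  + by split; [rewrite /= orbF; apply/eqP | exists n].
- case: n rK => // n rK.
  have n1 : ~ has_level c T1.
    by move=> h; apply: nT; apply: has_level_sub h => z /=; rewrite mem_cat => ->.
  have n2 : ~ has_level c T2.
    by move=> h; apply: nT; apply: has_level_sub h => z /=; rewrite mem_cat => ->; rewrite orbT.
  have r1 := crun_seq1 r.
  have fr1 : fresh_for c.+1 T1 pi Z.
    rewrite -[pi]cats0; apply: fresh_forW fr => z /=; by rewrite mem_cat => ->.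
  have [i1 [t1 [p1 fo1 fin1 ag1 [nw1 [m1 rm1]]]]] := IH1 _ _ _ _ r1 fo fin n1 rK fr1.
  have r2 := crun_trans r1 (paths_crun _ p1).
  have fr2 : fresh_for c.+1 T2 (pi ++ t1) Z.
    by apply: fresh_forW fr => z /=; rewrite mem_cat => ->; rewrite orbT.
  have [i2 [t2 [p2 fo2 fin2 ag2 [nw2 rm2]]]] := IH2 _ _ _ _ r2 fo1 fin1 n2 rm1 fr2.
  exists i2, (t1 ++ t2); rewrite catA has_cat negb_or nw1 nw2; split=> //.
    exact: paths_seq.
  exact: agree_catW ag2 ag1.
- have [lC|lC] := pselect (has_level c.+1 (If l x T1 T2)); last exact: (dontcare _ _ _ _ _ r fo fin nT rK lC).
  pose h : header := existT _ p (l, x).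
  have hC : phead (If l x T1 T2) = Some h by [].
  case: n rK => // n /(reach_phead _ _ _ _ hC) [[lh _]|[b rb]].
    by case: nT; exists (hsym h) => //; rewrite /= inE eqxx.
  have [i1 [r1 fo1 fin1 ag1]] := steer b r hC fo fin fr (hname_preds hC) lC.
  have ns : ~ has_level c (side (If l x T1 T2) b).
    by move=> hs; apply: nT; apply: has_level_sub hs; apply: sub_lsyms_side hC.
  have fr1 : fresh_for c.+1 (side (If l x T1 T2) b) (rcons pi (hletter h b)) Z.
    by rewrite -cats1; apply: fresh_forW fr; apply: sub_preds_side hC.
  have [i2 [t2 [p2 fo2 fin2 ag2 [nw2 rm2]]]] :
      exists i' tau, [/\ paths (side (If l x T1 T2) b) tau,
      follows i' (rcons pi (hletter h b) ++ tau), finite_support i',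
      agree i' i1 (atoms (rcons pi (hletter h b)) ++ Z)
      & ~~ has (assigns w) tau /\ exists n', reach c w n' K].
    by case: b r1 rb fo1 ns fr1 ag1 => r1 rb fo1 ns fr1 ag1; [apply: IH1 rb fr1 | apply: IH2 rb fr1].
  exists i2, (LPred l x b :: t2); rewrite -cat_rcons; split=> //.
    exact: paths_If.
  by rewrite -cats1 in ag2; apply: agree_catW ag2 ag1.
- have [lC|lC] := pselect (has_level c.+1 (While l y T)); last exact: (dontcare _ _ _ _ _ r fo fin nT rK lC).
  pose h : header := existT _ q (l, y).
  have hC : phead (While l y T) = Some h by [].
  (* The loop is left at once, so its body cannot assign [w]. *)
  have [i1 [r1 fo1 fin1 ag1]] := steer false r hC fo fin fr (hname_preds hC) lC.
  have [m _ rm] := reach_skip nT rK.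
  exists i1, [:: LPred l y false]; rewrite cats1; split=> //; last by split=> //; exists m.
  exact: paths_while_false.
Qed.

(** The run is steered into the branches enclosing [f^(l)], a loop being entered for one round;
    behind the assignment, [avoid] crosses the rest of [T] while keeping the new value of [w]. *)
Lemma pass_through c w f (l : L) T K pi i Z :
  level c.+1 (inl (f, l)) ->
  (forall y (x : {ffun 'I_(arF f) -> V}) K', In (Assign y l x :: K') (conts S [::]) ->
     y = w /\ exists n, reach c w n K') ->
  inl (f, l) \in lsyms T ->
  crun [:: S] pi (T :: K) -> follows i pi -> finite_support i ->
  ~ has_level c T -> fresh_for c.+1 T pi Z ->
  exists i' t1 (x : {ffun 'I_(arF f) -> V}) t2,
    [/\ paths T (t1 ++ LAssign w l x :: t2),
        follows i' (pi ++ t1 ++ LAssign w l x :: t2), finite_support i',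
        agree i' i (atoms pi ++ Z)
      & ~~ has (assigns w) t2 /\ exists n, reach c w n K].
Proof.
move=> lf Hf.
elim: T K pi i => [//|y g m x|T1 IH1 T2 IH2|p m x T1 IH1 T2 IH2|q m y T IH]
  K pi i fT r fo fin nT fr.
- move: fT; rewrite /= inE => /eqP [Ef El]; subst g m.
  have [-> rK] := Hf _ _ _ (crun_In_conts r).
  exists i, [::], x, [::]; rewrite /= cats1; split=> //; first exact: paths_assign.
  exact: follows_rcons_assign.
- have n1 : ~ has_level c T1.
    by move=> h; apply: nT; apply: has_level_sub h => z /=; rewrite mem_cat => ->.
  have n2 : ~ has_level c T2.
    by move=> h; apply: nT; apply: has_level_sub h => z /=; rewrite mem_cat => ->; rewrite orbT.
  have r1 := crun_seq1 r.
  have fr2 t : fresh_for c.+1 T2 (pi ++ t) Z.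
    by apply: fresh_forW fr => z /=; rewrite mem_cat => ->; rewrite orbT.
  move: fT; rewrite /= mem_cat => /orP[fT|fT].
    have fr1 : fresh_for c.+1 T1 pi Z.
      rewrite -[pi]cats0; apply: fresh_forW fr => z /=; by rewrite mem_cat => ->.
    have [i1 [t1 [x [t2 [p1 fo1 fin1 ag1 [nw1 [n rn]]]]]]] := IH1 _ _ _ fT r1 fo fin n1 fr1.
    have r2 := crun_trans r1 (paths_crun _ p1).
    have [i2 [t3 [p2 fo2 fin2 ag2 [nw2 rm2]]]] := avoid r2 fo1 fin1 n2 rn (fr2 _).
    exists i2, t1, x, (t2 ++ t3); rewrite has_cat negb_or nw1 nw2; split=> //.
    + by have := paths_seq p1 p2; rewrite -catA.
    + by move: fo2; rewrite -!catA.
    + exact: agree_catW ag2 ag1.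
  (* What precedes the part with [f^(l)] may take any terminating path. *)
  have [t1 p1 fo1] := run_finite freeS r1 fo fin.
  have r2 := crun_trans r1 (paths_crun _ p1).
  have [i2 [t2 [x [t3 [p2 fo2 fin2 ag2 [nw2 rm2]]]]]] := IH2 _ _ _ fT r2 fo1 fin n2 (fr2 _).
  exists i2, (t1 ++ t2), x, t3; split=> //.
  + by rewrite -catA; apply: paths_seq.
  + by move: fo2; rewrite -!catA.
  + exact: agree_catW ag2 (@agree_refl _ _).
- pose h : header := existT _ p (m, x).
  have hC : phead (If m x T1 T2) = Some h by [].
  have lC : has_level c.+1 (If m x T1 T2) by exists (inl (f, l)).
  have [b fb] : exists b, inl (f, l) \in lsyms (side (If m x T1 T2) b).
    move: fT; rewrite /= inE mem_cat /= => /orP[fT|fT]; by [exists true|exists false].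
  have [i1 [r1 fo1 fin1 ag1]] := steer b r hC fo fin fr (hname_preds hC) lC.
  have ns : ~ has_level c (side (If m x T1 T2) b).
    by move=> hs; apply: nT; apply: has_level_sub hs; apply: sub_lsyms_side hC.
  have fr1 : fresh_for c.+1 (side (If m x T1 T2) b) (rcons pi (hletter h b)) Z.
    by rewrite -cats1; apply: fresh_forW fr; apply: sub_preds_side hC.
  have [i2 [t1 [z [t2 [p2 fo2 fin2 ag2 rm2]]]]] :
      exists i' t1 (z : {ffun 'I_(arF f) -> V}) t2,
      [/\ paths (side (If m x T1 T2) b) (t1 ++ LAssign w l z :: t2),
        follows i' (rcons pi (hletter h b) ++ t1 ++ LAssign w l z :: t2),
        finite_support i', agree i' i1 (atoms (rcons pi (hletter h b)) ++ Z)
      & ~~ has (assigns w) t2 /\ exists n, reach c w n K].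
    by case: b r1 fb fo1 ns fr1 ag1 => r1 fb fo1 ns fr1 ag1; [apply: IH1 fr1 | apply: IH2 fr1].
  exists i2, (LPred m x b :: t1), z, t2; split=> //.
  + exact: paths_If.
  + by move: fo2; rewrite cat_rcons.
  + by rewrite -cats1 in ag2; apply: agree_catW ag2 ag1.
- pose h : header := existT _ q (m, y).
  have hC : phead (While m y T) = Some h by [].
  have lC : has_level c.+1 (While m y T) by exists (inl (f, l)).
  have fT' : inl (f, l) \in lsyms T by move: fT; rewrite /= inE.
  have [i1 [r1 fo1 fin1 ag1]] := steer true r hC fo fin fr (hname_preds hC) lC.
  have ns : ~ has_level c T.
    by move=> hs; apply: nT; apply: has_level_sub hs; apply: (sub_lsyms_side (b := true) hC).
  have fr1 : fresh_for c.+1 T (rcons pi (hletter h true)) Z.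
    by rewrite -cats1; apply: fresh_forW fr; apply: (sub_preds_side (b := true) hC).
  have [i2 [t1 [z [t2 [p2 fo2 fin2 ag2 [nw2 [n rn]]]]]]] := IH _ _ _ fT' r1 fo1 fin1 ns fr1.
  have r2 := crun_trans r1 (paths_crun _ p2).
  have fr2 : fresh_for c.+1 (While m y T)
      (rcons pi (hletter h true) ++ t1 ++ LAssign w l z :: t2) Z.
    by rewrite cat_rcons; apply: fresh_forW fr.
  have [i3 [t3 [p3 fo3 fin3 ag3 [nw3 rm3]]]] := avoid r2 fo2 fin2 nT rn fr2.
  exists i3, (LPred m y true :: t1), z, (t2 ++ t3); rewrite has_cat negb_or nw2 nw3.
  split=> //.
  + by have := paths_while_true p2 p3; rewrite -catA.
  + by move: fo3; rewrite -!catA cat_rcons.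
  + have ag := agree_catW ag3 ag2; rewrite -cats1 in ag; exact: agree_catW ag ag1.
Qed.

Lemma subschema_uniq_preds C T : subschema C T -> uniq (preds T) -> uniq (preds C).
Proof.
elim: T => [|y f l x|U1 IH1 U2 IH2|p l x U1 IH1 U2 IH2|q l y U IH];
  case=> [->//|] //=.
- by rewrite cat_uniq => -[/IH1|/IH2] h /and3P[? _ ?]; apply: h.
- by rewrite cat_uniq => -[/IH1|/IH2] h /and4P[_ ? _ ?]; apply: h.
- by move/IH=> h /andP[_ ?]; apply: h.
Qed.

(** With predicate-linearity, the predicate symbol alone names the program point. *)
Lemma pred_config_uniq C K h C' K' h' :
  In (C :: K) (conts S [::]) -> In (C' :: K') (conts S [::]) ->
  phead C = Some h -> phead C' = Some h' -> hname h = hname h' ->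
  C = C' /\ K = K'.
Proof.
move=> cC cC' /head_sym_phead sC /head_sym_phead sC' hh'.
apply: (conts_uniq labS cC cC' sC); rewrite sC'; congr Some; apply/esym.
have := linS; rewrite /predicate_linear preds_pmap => up.
apply: (uniq_pmap_inj (b := hname h) up (conts_sym cC sC) (conts_sym cC' sC')) => //.
by rewrite /= hh'.
Qed.

Lemma inner_pred_config C K C' K' h' :
  In (C :: K) (conts S [::]) -> In (C' :: K') (conts S [::]) ->
  phead C' = Some h' -> hname h' \in preds C ->
  In (C' :: K') (conts C K) /\ {subset lsyms C' <= lsyms C}.
Proof.
move=> cC cC' hC'; rewrite preds_pmap mem_pmap => /mapP [[//|[q l]] xC [Eq]].
have [C1 sub sC1] := lsyms_subschema xC.
have [K1 cC1] := subschema_conts K sub.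
have [h1 hC1] : exists h1, phead C1 = Some h1.
  by case: C1 {sub cC1} sC1 => //= p m x *; [exists (existT _ p (m, x)) | exists (existT _ p (m, x))].
have Eh : hname h' = hname h1.
  by move: sC1; rewrite (head_sym_phead hC1) => -[E1 _]; rewrite E1.
have [-> ->] := pred_config_uniq cC' (conts_trans cC cC1) hC' hC1 Eh.
by split=> //; apply: subschema_lsyms.
Qed.

Definition head_fun (t : term) : option F :=
  if t is @App _ _ _ f _ then Some f else None.

Lemma paths_While_false q (l : L) (y : {ffun 'I_(arP q) -> V}) T tau :
  paths (side (While l y T) false) tau -> tau = [::].
Proof. by move=> pt; inversion pt. Qed.

(* One run takes the branch containing the level [c.+1] assignment [f^(l)], the
   other the opposite branch. *)
Lemma split_runs C K h b f (l : L) w c pi1 pi2 i (pt : atom) :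
  phead C = Some h -> crun [:: S] pi1 (C :: K) -> crun [:: S] pi2 (C :: K) ->
  inl (f, l) \in lsyms (side C b) -> level c.+1 (inl (f, l)) ->
  ~ has_level c C ->
  (forall y (x : {ffun 'I_(arF f) -> V}) K', In (Assign y l x :: K') (conts S [::]) ->
     y = w /\ exists n, reach c w n K') ->
  finite_support i -> In pt (atoms (rcons pi1 (hletter h b))) ->
  follows i (rcons pi1 (hletter h b)) ->
  follows (flip pt i) (rcons pi2 (hletter h (~~ b))) ->
  fresh_for c.+1 C pi1 (atoms pi2) ->
  exists i' tau1 tau2,
    [/\ paths C tau1, paths C tau2, finite_support i', follows i' (pi1 ++ tau1)
      & follows (flip pt i') (pi2 ++ tau2)] /\
    [/\ exists n, reach c w n K,
        forall v, run pi1 v <> run (pi1 ++ tau1) w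
      & has (assigns w) tau2 -> run (pi1 ++ tau1) w <> run (pi2 ++ tau2) w].
Proof.
move=> hC r1 r2 fC lf nC Hf fin pt1 fo1 fo2 fr.
have CS : subschema C S by apply: conts_subschema (crun_In_conts r1) (head_sym_phead hC).
have lC : has_level c.+1 C by exists (inl (f, l)) => //; apply: sub_lsyms_side hC _ fC.
have r1b := crun_rcons_next r1 (next_pred K b hC).
have r2b := crun_rcons_next r2 (next_pred K (~~ b) hC).
have nb : ~ has_level c (side C b).
  by move=> hs; apply: nC; apply: has_level_sub hs; apply: sub_lsyms_side hC.
(* The second run is finished first; [Z] then freezes every predicate term it has met. *)
have [t3 p3 fo3] := run_finite freeS r2b fo2 (finite_flip pt fin).
pose Z := atoms (rcons pi2 (hletter h (~~ b)) ++ t3).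
(* A predicate term of [Z] comes from [pi2], from the test itself or from the opposite branch; by
   predicate-linearity the last two cannot have a predicate of the chosen branch. *)
have frb : fresh_for c.+1 (side C b) (rcons pi1 (hletter h b)) Z.
  move=> A; have /(subschema_uniq_preds CS) := linS; rewrite (preds_phead hC) /=.
  rewrite mem_cat negb_or cat_uniq => /and4P[/andP[n1 n2] _ /hasPn n12 _].
  rewrite /Z atoms_cat atoms_rcons_pred !In_cat => -[[A2|[<-|//]]|At3] Ab cA.
  - rewrite atoms_rcons_pred In_cat; left; apply: fr A2 _ cA.
    exact: sub_preds_side hC _ Ab.
  - by move: n1 n2 Ab => /=; case: (b) => [/negbTE->|_ /negbTE->].
  - have := tests_preds p3 At3; case: (b) Ab => /= Ab Ab'.
      by have := n12 _ Ab'; rewrite Ab.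
    by have := n12 _ Ab; rewrite Ab'.
have [i' [t1 [x [t2 [p1 fo' fin' ag' [nw rK]]]]]] := pass_through lf Hf fC r1b fo1 fin nb frb.
have sub1 : subschema (Assign w l x) (side C b).
  by apply: (paths_sound p1 (a := LAssign w l x)); apply/In_cat; right; left.
have foZ i'' : agree i'' i' (atoms (rcons pi1 (hletter h b) ++ t1 ++ LAssign w l x :: t2) ++ Z) ->
    follows (flip pt i'') (pi2 ++ hletter h (~~ b) :: t3).
  move=> ag''; rewrite -cat_rcons; apply: agree_follows fo3; apply: agree_flip => A AZ.
  by rewrite ag'' ?ag' // In_cat; right.
destruct C as [|y' f' l' x'|U1 U2|p m y T1 T2|q m y T]; try discriminate hC;
  have {hC} Eh := esym (Some_inj hC); subst h.
- exists i', (LPred m y b :: t1 ++ LAssign w l x :: t2), (LPred m y (~~ b) :: t3).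
  split; first split=> //.
  + exact: paths_If.
  + exact: paths_If.
  + by rewrite -cat_rcons.
  + exact: foZ (@agree_refl _ _).
  have r3 := crun_trans r1b (paths_crun _ p1); rewrite cat_rcons in r3.
  split=> // [v|/= /assigned_split [s1 [g [k [z [s2 [Et3 ns2]]]]]]].
    exact: (new_value freeS liberalS (t1 := LPred m y b :: t1) r3 nw).
  have sub2 : subschema (Assign w k z) (side (If m y T1 T2) (~~ b)).
    apply: (paths_sound p3 (a := LAssign w k z)); rewrite Et3; apply/In_cat.
    by right; left.
  (* Equal values would have the same outermost symbol, assigning [w] in both parts. *)
  rewrite Et3 -!cat_cons !catA !run_last_assigned // => /(congr1 head_fun) [Efg].
  subst g; have := disjS CS; case: (b) sub1 sub2 => s1' s2' dS.
    exact: (dS _ _ _ _ _ _ _ s1' s2').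
  exact: (dS _ _ _ _ _ _ _ s2' s1').
(* For a loop, [b] is true, because the exit branch contains no symbol. *)
- destruct b; last by [].
  pose h : header := existT _ q (m, y).
  have r3 := crun_trans r1b (paths_crun _ p1).
  set pi3 := rcons _ _ ++ _ in r3 fo' foZ.
  have frA := fresh_test freeS r3 (erefl : phead (While m y T) = Some h).
  have [i3 [fo4 fin4 ag4]] : exists i3, [/\ follows i3 (rcons pi3 (hletter h false)),
      finite_support i3 & agree i3 i' (atoms pi3 ++ Z)].
    (* The first run must now leave the loop. If the second run has met this predicate term, it was
       at its own exit test, so the answer is already false ([pt] is excluded, as the first run met
       it before). Otherwise the answer can be set. *)
    have [AZ|nAZ] := pselect (In (hatom (run pi3) h) Z).
      exists i'; split=> //; apply/follows_rcons_pred; split=> //.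
      rewrite ag'; last by apply/In_cat; right.
      move: AZ; rewrite /Z atoms_cat atoms_rcons_pred !In_cat => -[[A2|[EA|//]]|].
      + case: frA; rewrite /pi3 atoms_cat atoms_rcons_pred !In_cat; left; left.
        apply: fr A2 _ _; first exact: (hname_preds (C := While m y T)).
        by exists (While m y T), K, h; split=> //; apply: crun_In_conts r1.
      + have /follows_rcons_pred [_] := fo2; rewrite EA value_flip.
        case: asboolP => // Ept; case: frA; rewrite /pi3 atoms_cat In_cat; left.
        by rewrite Ept.
      + by rewrite (paths_While_false p3).
    exists (upd i' (hatom (run pi3) h) false); split.
    + exact: follows_upd_rcons.
    + exact: finite_upd.
    + by apply: agree_upd; rewrite In_cat; case.
  exists i3, (LPred m y true :: (t1 ++ LAssign w l x :: t2) ++ [:: LPred m y false]),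
    (LPred m y false :: t3).
  have pC := paths_while_true p1 (paths_while_false m y T).
  split; first split=> //.
  + by rewrite (paths_While_false p3); apply: paths_while_false.
  + by rewrite -cat_rcons catA cats1.
  + exact: foZ.
  have {}rK : exists n, reach c w n K.
    by have [n /(reach_skip nC) [n' _ rn']] := rK; exists n'.
  split=> // [v|]; last by rewrite (paths_While_false p3).
  have := crun_trans r1 (paths_crun _ pC); rewrite -catA -cat_cons => r4.
  by apply: (new_value freeS liberalS r4); rewrite has_cat negb_or nw.
Qed.

(** * Couples *)

Definition lonely pi1 pi2 (A : atom) : Prop :=
  (In A (atoms pi1) /\ ~ In A (atoms pi2)) \/
  (In A (atoms pi2) /\ ~ In A (atoms pi1)).

(** First, the two runs need not be sent into different branches of [q]. Second, either the branches
    of [q] cannot disturb [w], or a way of [n] steps to the use no longer meets [q]. *)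
Definition harmless r w n (q : P) : Prop :=
  forall C K h, In (C :: K) (conts S [::]) -> phead C = Some h -> hname h = q ->
  ~ has_level r C /\ (~ has_level r.+1 C \/ ~ reach r w n (C :: K)).

(* Two executions that stand at the same place, under interpretations that
   differ only at [pt], with different values of a variable [w] that can still
   influence [u]. A predicate term met by only one of them never constrains
   the tests that remain to be steered. *)
Record situation (pt : atom) r w n K i pi1 pi2 : Prop := Situation {
  sit_run1 : crun [:: S] pi1 K;
  sit_run2 : crun [:: S] pi2 K;
  sit_finite : finite_support i;
  sit_follows1 : follows i pi1;
  sit_follows2 : follows (flip pt i) pi2;
  sit_pt1 : In pt (atoms pi1);
  sit_pt2 : In pt (atoms pi2);
  sit_reach : reach r w n K;
  sit_diff : run pi1 w <> run pi2 w;
  sit_lonely : forall A, lonely pi1 pi2 A -> harmless r w n (projT1 A) }.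

Lemma harmless_le r w n n' q : n' <= n -> harmless r w n q -> harmless r w n' q.
Proof.
move=> nn' ok C K h cC hC Eq; have [nr [?|nre]] := ok _ _ _ cC hC Eq; split=> //.
  by left.
by right=> /(reach_le nn').
Qed.

(** Below level [r] the variable and the number of steps no longer matter: the absence of level [r]
    already excludes level [c.+1]. *)
Lemma harmless_lt r c w w' n n' q : c < r -> harmless r w n q -> harmless c w' n' q.
Proof.
move=> cr ok C K h cC hC Eq; have [nr _] := ok _ _ _ cC hC Eq.
by split; [|left] => hc; apply: nr; apply: has_level_le hc; first exact: ltnW.
Qed.

Lemma lonely_cat pi1 pi2 t1 t2 A : lonely (pi1 ++ t1) (pi2 ++ t2) A ->
  lonely pi1 pi2 A \/
  In A (map fst (tests (run pi1) t1)) \/ In A (map fst (tests (run pi2) t2)).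
Proof.
rewrite /lonely !atoms_cat !In_cat => -[[[A1|A1] nA]|[[A2|A2] nA]].
- by left; left; split=> // A2; apply: nA; left.
- by right; left.
- by left; right; split=> // A1; apply: nA; left.
- by right; right.
Qed.

(** The result type does not depend on the term, so equal applications give equal arguments by
    congruence, without dependent inversion. *)
Definition nth_arg k (t : term) : option term :=
  if t is @App _ _ _ f ts then omap ts (insub k : option 'I_(arF f)) else None.

Lemma App_arg_inj f (ts ts' : {ffun 'I_(arF f) -> term}) : App ts = App ts' -> ts =1 ts'.
Proof.
by move=> E k; have := congr1 (nth_arg k) E; rewrite /= valK /= => -[].
Qed.

Definition nth_atom_arg k (A : atom) : option term :=
  omap (projT2 A) (insub k : option 'I_(arP (projT1 A))).

(** Hence runs that differ at an argument of a test evaluate different predicate terms there. *)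
Lemma hatom_arg_inj d d' h w : hatom d h = hatom d' h -> w \in codom (hargs h) ->
  d w = d' w.
Proof.
move=> E /codomP [k ->]; have := congr1 (nth_atom_arg k) E.
by rewrite /nth_atom_arg /= valK /= !ffunE => -[].
Qed.

Lemma App_veval_inj d d' f (x : {ffun 'I_(arF f) -> V}) w :
  App (veval d x) = App (veval d' x) -> w \in codom x -> d w = d' w.
Proof.
move=> /App_arg_inj E /codomP [k ->]; by have := E k; rewrite !ffunE.
Qed.

Lemma atoms_rcons_assign pi y f (l : L) (x : {ffun 'I_(arF f) -> V}) :
  atoms (rcons pi (LAssign y l x)) = atoms pi.
Proof. by rewrite -cats1 atoms_cat /= cats0. Qed.

Lemma level_min r x : level r x -> exists c, [/\ c < r, level c.+1 x & ~ level c x].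
Proof.
move=> rx; have ex : exists r, `[< level r x >] by exists r; apply/asboolP.
case: (ex_minnP ex) => -[|c] /asboolP cx cmin //.
exists c; split=> //; first by apply: cmin; apply/asboolP.
by move=> /asboolP /cmin; rewrite ltnn.
Qed.

Lemma assign_target c f (l : L) : inl (f, l) \in lsyms S ->
  level c.+1 (inl (f, l)) -> ~ level c (inl (f, l)) ->
  exists w, forall y (x : {ffun 'I_(arF f) -> V}) K,
    In (Assign y l x :: K) (conts S [::]) -> y = w /\ exists n, reach c w n K.
Proof.
move=> fS lf nlf; have [C CS sC] := lsyms_subschema fS.
have [K0 cC] := subschema_conts [::] CS.
case: C sC {CS} cC => //= y g m z [Ef El]; subst g m => cC.
exists y => y' x K cC'; have [Ey EK] := assign_uniq cC cC'.
by split=> //; rewrite -Ey; apply: level_reach cC' lf nlf.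
Qed.

(** Both predicate terms are new to both runs, and neither is [pt], which the first run has met; so
    the outcomes can be prescribed independently unless the terms coincide. *)
Lemma steer_both pt i pi1 pi2 h b1 b2 :
  let A1 := hatom (run pi1) h in let A2 := hatom (run pi2) h in
  let i' := upd (upd i A1 b1) A2 b2 in
  finite_support i -> follows i pi1 -> follows (flip pt i) pi2 ->
  In pt (atoms pi1) -> ~ In A1 (atoms pi1) -> ~ In A1 (atoms pi2) ->
  ~ In A2 (atoms pi1) -> ~ In A2 (atoms pi2) -> (A1 = A2 -> b1 = b2) ->
  [/\ finite_support i', follows i' (rcons pi1 (hletter h b1))
    & follows (flip pt i') (rcons pi2 (hletter h b2))].
Proof.
move=> A1 A2 i' fin fo1 fo2 pt1 n11 n12 n21 n22 eqb.
have ag Z : ~ In A1 Z -> ~ In A2 Z -> agree i' i Z.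
  by move=> n1 n2; apply: agree_trans (agree_upd _ _ n2) (agree_upd _ _ n1) _.
split; first exact/finite_upd/finite_upd.
- apply/follows_rcons_pred; split; first by apply: agree_follows fo1; apply: ag.
  have [E|ne] := pselect (A1 = A2); last by rewrite value_upd_neq // value_upd_eq.
  by rewrite -/A1 E value_upd_eq eqb.
- apply/follows_rcons_pred; split.
    by apply: agree_follows fo2; apply/agree_flip/ag.
  by rewrite value_flip value_upd_eq asboolF // => E; apply: n21; rewrite /A2 E.
Qed.

Lemma split_situation pt C K h c w i pi1 pi2 tau1 tau2 :
  phead C = Some h -> crun [:: S] pi1 (C :: K) -> crun [:: S] pi2 (C :: K) ->
  ~ has_level c C -> paths C tau1 -> paths C tau2 -> finite_support i ->
  follows i (pi1 ++ tau1) -> follows (flip pt i) (pi2 ++ tau2) ->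
  In pt (atoms (pi1 ++ tau1)) -> In pt (atoms (pi2 ++ tau2)) ->
  (exists n, reach c w n K) -> run (pi1 ++ tau1) w <> run (pi2 ++ tau2) w ->
  (forall A n, lonely pi1 pi2 A -> harmless c w n (projT1 A)) ->
  exists n, situation pt c w n K i (pi1 ++ tau1) (pi2 ++ tau2).
Proof.
move=> hC r1 r2 nC p1 p2 fin fo1 fo2 pt1 pt2 [n0 rn0] df lo.
(* With [n] least, no test inside [C] is within [n] steps of the use, so the predicate terms met
   there by one run only are harmless. *)
have ex : exists n, `[< reach c w n K >] by exists n0; apply/asboolP.
case: (ex_minnP ex) => n /asboolP rn nmin.
exists n; split=> //.
- exact: crun_trans r1 (paths_crun _ p1).
- exact: crun_trans r2 (paths_crun _ p2).
move=> A /lonely_cat [/lo //|lA].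
have AC : projT1 A \in preds C by case: lA; apply: tests_preds.
move=> C1 K1 h1 cC1 hC1 Eq; rewrite -Eq in AC.
have [cc sub] := inner_pred_config (crun_In_conts r1) cC1 hC1 AC.
split; first by move=> /(has_level_sub sub).
right=> /(reach_conts nC cc) [n' n'n /asboolP /nmin].
by rewrite leqNgt n'n.
Qed.

(** Lexicographic induction: either the way to the use gets shorter at the same level, or the
    difference moves to a variable with a use of lower level. *)
Lemma situation_couple pt r w n K i pi1 pi2 :
  situation pt r w n K i pi1 pi2 ->
  exists i', couple_for S (projT2 pt) u i' (flip pt i').
Proof.
elim/ltn_ind: r w n K i pi1 pi2 => r IHr w n.
elim: n w => [|n IHn] w K i pi1 pi2 [r1 r2 fin fo1 fo2 pt1 pt2 rK df lo] //.
have lo' A : lonely pi1 pi2 A -> harmless r w n (projT1 A).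
  by move=> /lo; apply: harmless_le.
(* So [n.+1] is least; this makes a test at the head of the stack harmless once it is passed, if it
   contains no symbol of level [r]. *)
have [rKn|nmin] := pselect (reach r w n K); first by apply: (IHn w K i pi1 pi2).
case: K r1 r2 rK nmin => [|C K] r1 r2 rK nmin.
  exists i; split.
    split; first by rewrite -!/(value _ pt) value_flip asboolT //=; case: (value i pt).
    move=> q s; rewrite /flip; case: asboolP => [-> //|_]; by rewrite atomK.
  exists (run pi1), (run pi2); split; last by rewrite -rK.
    by exists pi1 => //; apply: crun_execution.
  by exists pi2 => //; apply: crun_execution.
case hC: (phead C) => [h|]; last first.
  case: C hC r1 r2 rK {nmin} => //.
  - move=> _ r1 r2 rK; apply: (IHn w K i pi1 pi2); split=> //.
    + by rewrite -[pi1]cats0; apply: crun_trans r1 (crun_skip (crun_refl _)).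
    + by rewrite -[pi2]cats0; apply: crun_trans r2 (crun_skip (crun_refl _)).
  - move=> y f l x _ r1 r2 rK.
    have r1' := crun_rcons_next r1 (conj erefl erefl : next (Assign y l x) K _ K).
    have r2' := crun_rcons_next r2 (conj erefl erefl : next (Assign y l x) K _ K).
    have fo1' : follows i (rcons pi1 (LAssign y l x)) by apply: follows_rcons_assign.
    have fo2' : follows (flip pt i) (rcons pi2 (LAssign y l x)).
      exact: follows_rcons_assign.
    case: rK => [[lf wx]|[yw rK]].
      have [c [cr lc nlc]] := level_min lf.
      have [n' rn'] := level_reach (crun_In_conts r1) lc nlc.
      apply: (IHr c cr y n' K i (rcons pi1 (LAssign y l x)) (rcons pi2 (LAssign y l x))).
      split=> //.
      + by rewrite atoms_rcons_assign.
      + by rewrite atoms_rcons_assign.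
      + by rewrite -!cats1 !run_last_assigned // => /App_veval_inj /(_ wx).
      + move=> A; rewrite /lonely !atoms_rcons_assign => /lo; exact: harmless_lt.
    apply: (IHn w K i (rcons pi1 (LAssign y l x)) (rcons pi2 (LAssign y l x))).
    split=> //.
    + by rewrite atoms_rcons_assign.
    + by rewrite atoms_rcons_assign.
    + by rewrite -!cats1 !run_unassigned //= orbF; apply/eqP.
    + by move=> A; rewrite /lonely !atoms_rcons_assign => /lo'.
  - move=> T1 T2 _ r1 r2 rK; apply: (IHn w (T1 :: T2 :: K) i pi1 pi2); split=> //;
      exact: crun_seq1.
have cC := crun_In_conts r1.
set A1 := hatom (run pi1) h; set A2 := hatom (run pi2) h.
have n11 : ~ In A1 (atoms pi1) by apply: fresh_test freeS _ _ _ _ r1 hC.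
have n22 : ~ In A2 (atoms pi2) by apply: fresh_test freeS _ _ _ _ r2 hC.
(* Both runs take the branch leading on to the use. The test itself is no use of [w]: equal
   predicate terms exclude an argument with different values, and otherwise no symbol of [C] has
   level [r]. *)
have step : ~ In A1 (atoms pi2) -> ~ In A2 (atoms pi1) ->
    A1 = A2 \/ ~ has_level r C ->
    exists i', couple_for S (projT2 pt) u i' (flip pt i').
  move=> n12 n21 alt.
  have [b rb] : exists b, reach r w n (side C b :: ret C b K).
    move/(reach_phead _ _ _ _ hC): rK => [[lh wh]|//].
    case: alt => [/hatom_arg_inj /(_ wh) //|[]].
    by exists (hsym h) => //; rewrite (lsyms_phead hC) inE eqxx.
  have [fin' fo1' fo2'] := steer_both (b2 := b) fin fo1 fo2 pt1 n11 n12 n21 n22 (fun _ => erefl).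
  pose i' := upd (upd i A1 b) A2 b.
  apply: (IHn w _ i' (rcons pi1 (hletter h b)) (rcons pi2 (hletter h b))).
  apply: (Situation _ _ fin' fo1' fo2' _ _ rb).
  - exact: crun_rcons_next r1 (next_pred _ _ hC).
  - exact: crun_rcons_next r2 (next_pred _ _ hC).
  - by rewrite atoms_rcons_pred In_cat; left.
  - by rewrite atoms_rcons_pred In_cat; left.
  - by rewrite !run_rcons_pred.
  have ok : ~ has_level r C -> harmless r w n (hname h).
    move=> nC C1 K1 h1 cC1 hC1 Eq.
    by have [-> ->] := pred_config_uniq cC1 cC hC1 hC Eq; split=> //; right.
  move=> A lA; case: alt => [E|nC]; last first.
    by move: lA; rewrite -!cats1 => /lonely_cat [/lo' //|[[<-|//]|[<-|//]]]; apply: ok.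
  apply: lo'; move: lA; rewrite /lonely !atoms_rcons_pred !In_cat -/A1 -/A2 E.
  case=> -[[A_|A_] nA]; try by case: nA; right.
    by left; split=> // A_'; apply: nA; left.
  by right; split=> // A_'; apply: nA; left.
have [E|ne] := pselect (A1 = A2).
  by apply: step; [rewrite E | rewrite -E | left].
(* Without symbols of level [r.+1], each run can cross [C] on its own. *)
have [lC'|nlC'] := pselect (has_level r.+1 C); last first.
  have nlC : ~ has_level r C by move=> h'; apply: nlC'; apply: has_level_le h'.
  have [t1 p1 fo1'] := run_finite freeS r1 fo1 fin.
  have [t2 p2 fo2'] := run_finite freeS r2 fo2 (finite_flip pt fin).
  have [n' n'n rn'] := reach_skip nlC rK.
  have u1 := low_level_unassigned r1 p1 nlC' rn'.
  have u2 := low_level_unassigned r2 p2 nlC' rn'.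
  apply: (IHn w K i (pi1 ++ t1) (pi2 ++ t2)); split=> //.
  - exact: crun_trans (paths_crun _ p1).
  - exact: crun_trans (paths_crun _ p2).
  - exact: atoms_catl.
  - exact: atoms_catl.
  - by apply: reach_le rn'.
  - by rewrite !run_unassigned.
  move=> A /lonely_cat [/lo' //|lA].
  have AC : projT1 A \in preds C by case: lA; apply: tests_preds.
  move=> C1 K1 h1 cC1 hC1 Eq; rewrite -Eq in AC.
  have [cc sub] := inner_pred_config cC cC1 hC1 AC.
  by split; [|left] => /(has_level_sub sub).
(* [C] has a symbol of level [r.+1] and is within [n.+1] steps of the use, so its predicate is not
   harmless. *)
have lonelyF A : projT1 A = hname h -> ~ lonely pi1 pi2 A.
  by move=> EA /lo; rewrite EA => /(_ _ _ _ cC hC erefl) [_ []].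
have n12 : ~ In A1 (atoms pi2) by move=> h'; apply: (lonelyF A1) => //; right.
have n21 : ~ In A2 (atoms pi1) by move=> h'; apply: (lonelyF A2) => //; left.
have [lC|nlC] := pselect (has_level r C); last by apply: step => //; right.
(* Remaining case: different predicate terms, and symbols of level [r] in [C]. The runs are
   separated around a function symbol of least level in [C]. *)
have CS := conts_subschema cC (head_sym_phead hC).
have [c [b [f [l [cr nc fb lf nlf]]]]] := has_level_min CS hC lC.
have fS := subschema_lsyms CS (sub_lsyms_side hC fb).
have [w1 Hw1] := assign_target fS lf nlf.
have [fin' fo1' fo2'] := steer_both (b1 := b) (b2 := ~~ b) fin fo1 fo2 pt1 n11 n12 n21 n22
  (fun E => False_ind _ (ne E)).
have pt1' : In pt (atoms (rcons pi1 (hletter h b))).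
  by rewrite atoms_rcons_pred In_cat; left.
have fr : fresh_for c.+1 C pi1 (atoms pi2).
  move=> A A2' _ [C1 [K1 [h1 [cC1 hC1 Eq lC1]]]]; apply: contrapT => nA.
  have [|nr _] := lo A _ _ _ _ cC1 hC1 Eq; first by right.
  by apply: nr; apply: has_level_le lC1.
have [i' [t1 [t2 [[p1 p2 fini' fi1 fi2] [rc new df']]]]] :=
  split_runs hC r1 r2 fb lf nc Hw1 fin' pt1' fo1' fo2' fr.
have [E|df1] := pselect (run (pi1 ++ t1) w1 = run (pi2 ++ t2) w1); last first.
  have [||//|n' sit] := split_situation hC r1 r2 nc p1 p2 fini' fi1 fi2 _ _ rc df1.
  - exact: atoms_catl.
  - exact: atoms_catl.
  - by move=> A n' /lo; apply: harmless_lt.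
  exact: IHr sit.
(* The values of [w1] agree after [C], so the second run kept its old value while the first obtained
   a new one. Hence [w1] already differed before [C], and [t2] shows its use to be in reach from
   there: the induction resumes at [C] with the original [i]. *)
have u2 : ~~ has (assigns w1) t2 by apply/negP => /df'.
have [n1 rn1] := rc.
have [n2 rn2] := crun_reach (paths_crun K p2) u2 rn1.
apply: (IHr c cr w1 n2 (C :: K) i pi1 pi2); split=> //.
  by rewrite -(run_unassigned pi2 u2) -E; apply: new.
by move=> A /lo; apply: harmless_lt.
Qed.

Lemma paths_phead C h tau : phead C = Some h -> paths C tau ->
  exists b tau', tau = hletter h b :: tau'.
Proof.
move=> hC pt; case: pt hC => //=.
- by move=> p l x T1 T2 mu _ [<-]; exists true, mu.
- by move=> p l x T1 T2 mu _ [<-]; exists false, mu.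
- by move=> q l y T [<-]; exists false, [::].
- by move=> q l y T mu nu _ _ [<-]; exists true, (mu ++ nu).
Qed.

(** Both runs start from the same [pi] and part at this test, so no predicate term is lonely before
    it. That [pi] is arbitrary lets the vector of the couple be prescribed. *)
Lemma pred_couple r pi C K h :
  crun [:: S] pi (C :: K) -> phead C = Some h -> level r (hsym h) ->
  exists i j, couple_for S (veval (run pi) (hargs h)) u i j.
Proof.
move=> r1 hC lh; have cC := crun_In_conts r1.
have lC : has_level r C by exists (hsym h) => //; rewrite (lsyms_phead hC) inE eqxx.
have CS := conts_subschema cC (head_sym_phead hC).
have [c [b [f [l [cr nc fb lf nlf]]]]] := has_level_min CS hC lC.
have fS := subschema_lsyms CS (sub_lsyms_side hC fb).
have [w Hw] := assign_target fS lf nlf.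
have [i fin fo] := finite_follows freeS (crun_rcons_next r1 (next_pred K b hC)).
pose pt := hatom (run pi) h.
have npt : ~ In pt (atoms pi) by apply: fresh_test freeS _ _ _ _ r1 hC.
have ptb b' : In pt (atoms (rcons pi (hletter h b'))).
  by rewrite atoms_rcons_pred In_cat; right; left.
have fo2 : follows (flip pt i) (rcons pi (hletter h (~~ b))).
  move/follows_rcons_pred: fo => [fo vpt]; apply/follows_rcons_pred; split.
    apply: agree_follows fo => A Api; rewrite value_flip asboolF // => E.
    by rewrite E in Api.
  by rewrite value_flip asboolT // vpt; case: (b).
have [i' [t1 [t2 [[p1 p2 fini' fi1 fi2] [rc new df']]]]] :=
  split_runs hC r1 r1 fb lf nc Hw fin (ptb b) fo fo2 (fun A h _ _ => h).
(* If the second run does not assign [w], it keeps the value from before the test, which the first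
   run has replaced by a new one. *)
have df : run (pi ++ t1) w <> run (pi ++ t2) w.
  case: (boolP (has (assigns w) t2)) => [/df' //|u2].
  by rewrite (run_unassigned pi u2) => /esym /new.
have ptt t : paths C t -> In pt (atoms (pi ++ t)).
  by move=> /(paths_phead hC) [b' [t' ->]]; rewrite -cat_rcons; apply: atoms_catl.
have [|n sit] := split_situation hC r1 r1 nc p1 p2 fini' fi1 fi2 (ptt _ p1) (ptt _ p2) rc df.
  by move=> A n [[]|[]].
by have [i0 cp] := situation_couple sit; exists i0, (flip pt i0).
Qed.

(** * Propagation of function symbols and the two claims *)

Lemma vcontains_veval d n (x : {ffun 'I_n -> V}) w f :
  contains f (d w) -> w \in codom x -> vcontains f (veval d x).
Proof. by move=> cf /codomP [k E]; exists k; rewrite ffunE -E. Qed.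

(** On the way to the use, the value survives to the end as that of [u], is handed on to an assigned
    variable at a lower level, or becomes an argument of a needed predicate; then [pred_couple]
    gives a couple at the vector of this very path. *)
Lemma use_or_couple r w n K pi f :
  crun [:: S] pi K -> reach r w n K -> contains f (run pi w) ->
  (exists i d, terminates_in S i d /\ contains f (d u)) \/
  (exists p m (t : {ffun 'I_(arP p) -> term}),
     [/\ need S u (inr (p, m)), vcontains f t & exists i j, couple_for S t u i j]).
Proof.
elim/ltn_ind: r w n K pi => r IHr w n; elim: n => // n IHn [|C K] pi r1 rK cf.
  have [i _ fo] := finite_follows freeS r1.
  left; exists i, (run pi); rewrite -[u]rK; split=> //.
  by exists pi => //; apply: crun_execution.
case hC: (phead C) => [h|].
  move/(reach_phead _ _ _ _ hC): rK => [[lh wh]|[b rb]].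
    right; exists (hname h), (projT2 h).1, (veval (run pi) (hargs h)); split.
    - exact: level_need lh.
    - exact: vcontains_veval cf wh.
    - exact: pred_couple r1 hC lh.
  apply: IHn (crun_rcons_next r1 (next_pred K b hC)) rb _.
  by rewrite run_rcons_pred.
case: C hC r1 rK => //.
- move=> _ r1 rK; apply: IHn rK cf; rewrite -[pi]cats0.
  exact: crun_trans r1 (crun_skip (crun_refl _)).
- move=> y g l x _ r1 rK.
  have r1' := crun_rcons_next r1 (conj erefl erefl : next (Assign y l x) K _ K).
  case: rK => [[lf wx]|[yw rK]].
    have [c [cr lc nlc]] := level_min lf.
    have [n' rn'] := level_reach (crun_In_conts r1) lc nlc.
    apply: (IHr c cr y n' K _ r1' rn').
    by rewrite -cats1 run_last_assigned //; right; apply: vcontains_veval cf wx.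
  apply: IHn r1' rK _.
  by rewrite -cats1 run_unassigned //= orbF; apply/eqP.
- by move=> T1 T2 _ r1 rK; apply: IHn (crun_seq1 r1) rK cf.
Qed.

Lemma need_pred_couple p (l : L) : need S u (inr (p, l)) ->
  exists (t : {ffun 'I_(arP p) -> term}) i j, couple_for S t u i j.
Proof.
move=> nd; have [r lr] := need_level nd.
have [C [h [CS hC Eh]]] : exists C h, [/\ subschema C S, phead C = Some h
    & hsym h = inr (p, l)].
  inversion nd as [| |p' l' x _ en Ep].
  by have [C [h [b [CS hC Eh _]]]] := encloses_phead en; exists C, h.
have [K cC] := subschema_conts [::] CS.
have [pi r1] := conts_crun cC.
rewrite -Eh in lr; have [i [j cp]] := pred_couple r1 hC lr.
by case: Eh => <- _; exists (veval (run pi) (hargs h)), i, j.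
Qed.

Lemma need_fun_couple f (l : L) : need S u (inl (f, l)) ->
  (exists i d, terminates_in S i d /\ contains f (d u)) \/
  (exists p m (t : {ffun 'I_(arP p) -> term}),
     [/\ need S u (inr (p, m)), vcontains f t & exists i j, couple_for S t u i j]).
Proof.
move=> /need_level [r /level_min [c [_ lc nlc]]].
have [mu [y [x [nu ps]]]] : exists mu y (x : {ffun 'I_(arF f) -> V}) nu,
    paths S (mu ++ LAssign y l x :: nu).
  case: lc => [//|[g [m [[Ef El] fd]]]|[g [m [z [[Ef El] _ fd]]]]|[? [? [? []]]//]];
    subst g m.
    by have [mu [x [nu [ps _]]]] := fd; exists mu, u, x, nu.
  have [mu [y [x [nu [a [mu' [ps _ _ _]]]]]]] := fd.
  by exists mu, y, x, (nu ++ a :: mu').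
have [C [K1 [K2 [r1 st _]]]] := paths_split ps.
have [EC EK] := next_assign st; subst C K2.
have [n rn] := level_reach (crun_In_conts r1) lc nlc.
apply: (use_or_couple (crun_rcons_next r1 st) rn).
by rewrite -cats1 run_last_assigned //; left.
Qed.

End Need.

End Schemas.

Theorem theorem30 (F P V L : eqType) (arF : F -> nat) (arP : P -> nat)
    (infF : infinite_type F) (infP : infinite_type P)
    (infV : infinite_type V) (infL : infinite_type L)
    (S : schema V L arF arP) (labS : well_labelled S)
    (specS : special S) (u : V) :
  (forall (p : P) (l : L), need S u (inr (p, l)) ->
     exists (t : {ffun 'I_(arP p) -> term V arF}) (i j : interp V arF arP),
       couple_for S t u i j) /\
  (forall (f : F) (l : L), need S u (inl (f, l)) ->
     (exists (i : interp V arF arP) (d : state V arF),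
        terminates_in S i d /\ contains f (d u)) \/
     (exists (p : P) (m : L) (t : {ffun 'I_(arP p) -> term V arF}),
        [/\ need S u (inr (p, m)), vcontains f t
          & exists i j : interp V arF arP, couple_for S t u i j])).
Proof.
have [linS freeS liberalS disjS] := specS; split=> [p l|f l] nd.
  exact: need_pred_couple nd.
exact: need_fun_couple nd.
Qed.
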